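(* Let $1\le p\le\infty$, $1\le q\le\infty$, $s>\max(0,1/p-1/2)$, $B>0$, and let $\beta^0\in B^s_{p,q}(B)=\{\beta\in B^s_{p,q}[0,1]:\|\beta\|_{B^s_{p,q}}<B\}$. Let $\alpha=2s+1$ if $p\ge 2$ and $\alpha=2s+2-2/p$ if $1\le p<2$. For each $n$, let $\Pi_n$ be the prior under which the coefficients $\beta_{jk}$ are independent with $\beta_{jk}\sim \pi_jN(0,a_j^2)+(1-\pi_j)\delta_0$, where $a_j^2\asymp 2^{-\alpha j}$, $\pi_j\asymp 2^{-\gamma j}$ for some $\gamma\ge 0$, and $\alpha,\gamma$ are such that this prior puts positive mass on $B^s_{p,q}$. Let $\Pi_n(\cdot\mid X_{jk})$ be the corresponding posterior given the observations $X_{jk}=\beta^0_{jk}+z_{jk}/\sqrt n$ ($j\ge 0$, $0\le k\le 2^j-1$). Then for every sufficiently large constant $M$, $$\Pi_n\Big(\{\beta_{jk}\}:\ \sum_{j,k}(\beta_{jk}-\beta^0_{jk})^2>M\epsilon_n^2\ \Big|\ X_{jk}\Big)\rightarrow 0\quad\text{in probability as } n\to\infty,$$ where $\epsilon_n^2=(\log n)^2\,n^{-2s/(2s+1)}$ when $p\ge 2$, and $\epsilon_n^2=(\log n)^2\,n^{-(2s+1-2/p)/(2s+2-2/p)}$ when $1\le p<2$.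
   Context: Model: the white noise model $dX(t)=f(t)\,dt+n^{-1/2}dW(t)$ on $[0,1]$, with $f\in B^s_{p,q}[0,1]$ and $W$ standard Brownian motion, is expressed in a sufficiently regular wavelet basis of $[0,1]$ with lowest resolution $j_0=0$. This gives the Gaussian sequence model $X_{00}=\alpha^0_{00}+z_{00}/\sqrt n$ (scaling coefficient) and $X_{jk}=\beta^0_{jk}+z_{jk}/\sqrt n$, $j\ge 0$, $k=0,\dots,2^j-1$ (wavelet coefficients), where all the noise variables are independent standard normal and the superscript $0$ denotes the true parameter. The scaling coefficient $\alpha_{00}=\alpha_{00}^0$ is assumed known, so the unknown parameter is $\beta=(\beta_{jk})_{j\ge0,\,0\le k\le 2^j-1}$. Besov norm, in terms of coefficients: $\|\beta\|_{B^s_{p,q}}=|\alpha_{00}|+\{\sum_{j\ge 0}2^{j(s+1/2-1/p)q}\|\beta_{j\cdot}\|_p^q\}^{1/q}$, where $\|\beta_{j\cdot}\|_p$ is the $\ell_p$ norm of $(\beta_{jk})_{0\le k\le 2^j-1}$, with the usual supremum modification when $q=\infty$. $\delta_0$ is the point mass at $0$. The notation $u_j\asymp v_j$ means that $u_j/v_j$ is bounded above and below by positive constants. The posterior is the conditional distribution of $\beta$ given the data (Bayes' formula) when $\beta\sim\Pi_n$ and, given $\beta$, $X_{jk}\sim N(\beta_{jk},1/n)$ independently. ''In probability'' is with respect to the law of the data under the true $\beta^0$. *)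

(* Defs.v *)
From HB Require Import structures.
From mathcomp Require Import all_boot all_order all_algebra.
From mathcomp Require Import all_classical all_reals all_analysis.

Set Implicit Arguments.
Unset Strict Implicit.
Unset Printing Implicit Defensive.

Import Order.TTheory GRing.Theory Num.Theory.
Import numFieldNormedType.Exports.

Local Open Scope classical_set_scope.
Local Open Scope ring_scope.

Definition asymp {R : realType} (u v : nat -> R) : Prop :=
  exists c C : R, [/\ 0 < c, 0 < C & forall j, c <= u j / v j <= C].

(* Index set of the wavelet coefficients: pairs (j, k) with 0 <= k < 2 ^ j;
   the resolution level of an index i is tag i. *)
Definition windex : Type := {j : nat & 'I_(2 ^ j)}.

Definition widx (j : nat) (k : 'I_(2 ^ j)) : windex :=
  Tagged (fun j => 'I_(2 ^ j)) k.

Definition cylinders (R : realType) : set (set (windex -> R)) :=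
  [set C | exists i (A : set R),
     measurable A /\ C = [set b : windex -> R | A (b i)]].

(* Arrays of wavelet coefficients, with the product sigma-algebra. *)
Definition coefs (R : realType) := g_sigma_algebraType (@cylinders R).

Section besov.
Context {R : realType}.
Implicit Types (p q : \bar R) (s : R) (b : coefs R).

(* 1 / p, with 1 / +oo = 0 *)
Definition rinv p : R := fine (p^-1)%E.

(* Meant for 1 <= p <= +oo: the last branch is the case p = +oo. *)
Definition lp_norm p (m : nat) (x : 'I_m -> R) : R :=
  match p with
  | r%:E => (\sum_(k < m) `|x k| `^ r) `^ r^-1
  | _ => \big[Num.max/0]_(k < m) `|x k|
  end.

Definition level_norm p b (j : nat) : R :=
  lp_norm p (fun k : 'I_(2 ^ j) => b (widx k)).

(* As above, the last branch is the case q = +oo; the value is +oo outside of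
   the Besov space. *)
Definition besov_seminorm s p q b : \bar R :=
  match q with
  | r%:E =>
      ((\sum_(0 <= j <oo)
         (2 `^ (j%:R * (s + 2^-1 - rinv p) * r) * level_norm p b j `^ r)%:E)
        `^ r^-1)%E
  | _ =>
      ereal_sup (range (fun j : nat =>
        (2 `^ (j%:R * (s + 2^-1 - rinv p)) * level_norm p b j)%:E))
  end.

(* a00 is the scaling coefficient. *)
Definition besov_norm s p q (a00 : R) b : \bar R :=
  (`|a00|%:E + besov_seminorm s p q b)%E.

Definition besov_space s p q (a00 : R) : set (coefs R) :=
  [set b | (besov_norm s p q a00 b < +oo)%E].

Definition besov_ball s p q (a00 B : R) : set (coefs R) :=
  [set b | (besov_norm s p q a00 b < B%:E)%E].

Definition sq_dist (b b' : coefs R) : \bar R :=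
  (\sum_(0 <= j <oo) (\sum_(k < 2 ^ j) (b (widx k) - b' (widx k)) ^+ 2)%:E)%E.

Definition alpha s p : R :=
  if (2%:E <= p)%E then 2 * s + 1 else 2 * s + 2 - 2 * rinv p.

(* epsilon_n ^ 2 *)
Definition rate2 s p (n : nat) : R :=
  ln n%:R ^+ 2 *
  (if (2%:E <= p)%E
   then n%:R `^ (- (2 * s / (2 * s + 1)))
   else n%:R `^ (- ((2 * s + 1 - 2 * rinv p) / (2 * s + 2 - 2 * rinv p)))).

End besov.

Section probability.
Context {R : realType}.

Definition mutually_independent {d} {T : measurableType d} {I : eqType}
    (P : probability T R) (X : I -> T -> R) : Prop :=
  forall (s : seq I) (A : I -> set R),
    uniq s -> (forall i, measurable (A i)) ->
    P (\bigcap_(i in [set` s]) (X i @^-1` A i)) =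
    (\prod_(i <- s) P (X i @^-1` A i))%E.

Definition has_law {d} {T : measurableType d} (P : probability T R)
    (X : T -> R) (mu : set R -> \bar R) : Prop :=
  forall A : set R, measurable A -> P (X @^-1` A) = mu A.

Definition cvg_in_probability {d} {T : measurableType d} (P : probability T R)
    (Y : nat -> T -> \bar R) (l : R) : Prop :=
  forall e : R, 0 < e ->
    (fun n => P [set omega | (e%:E < `|Y n omega - l%:E|)%E]) @ \oo --> 0%E.

Definition std_gaussian_noise {d} {T : measurableType d} (P : probability T R)
    (z : windex -> {RV P >-> R}) : Prop :=
  mutually_independent P (fun i => z i : T -> R) /\
  forall i, has_law P (z i) (normal_prob 0 1).

(* w N(0, a ^ 2) + (1 - w) delta_0; the second argument of normal_prob is the
   standard deviation. *)
Definition spike_slab (w a : R) (A : set R) : \bar R :=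
  (w%:E * normal_prob 0 a A + (1 - w)%:E * \d_(0%R : R) A)%E.

Definition spike_slab_prior (w a : nat -> R) (Pi : probability (coefs R) R) :
    Prop :=
  mutually_independent Pi (fun (i : windex) (b : coefs R) => b i) /\
  forall i : windex,
    has_law Pi (fun b : coefs R => b i) (spike_slab (w (tag i)) (a (tag i))).

Definition obs {d} {T : measurableType d} (P : probability T R)
    (z : windex -> {RV P >-> R}) (n : nat) (b : coefs R) (omega : T) :
    coefs R :=
  fun i => b i + z i omega / Num.sqrt n%:R.

(* The Bayesian model is realised on the product of the parameter space and the
   noise space: under Pi \x P, the parameter b has law Pi and, given b, the
   coordinates of obs z n b are independent N(b i, 1/n). A posterior is a
   regular conditional distribution of b given the data, i.e. a probability
   kernel K with E[1_A(X) K(X, C)] = Pr(X \in A, b \in C) for all A and C. *)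
Definition is_posterior {d} {T : measurableType d} (P : probability T R)
    (z : windex -> {RV P >-> R}) (n : nat) (Pi : probability (coefs R) R)
    (K : R.-pker (coefs R) ~> (coefs R)) : Prop :=
  forall A C : set (coefs R), measurable A -> measurable C ->
    (\int[Pi \x P]_(x in [set x | A (obs z n x.1 x.2)])
        K (obs z n x.1 x.2) C)%E =
    (Pi \x P)%E [set x | A (obs z n x.1 x.2) /\ C x.1].

End probability.

(* Main.v *)
Require Import Defs.
From HB Require Import structures.
From mathcomp Require Import all_boot all_order all_algebra.
From mathcomp Require Import all_classical all_reals all_analysis.
From mathcomp Require Import measurable_realfun measurable_fun_approximation.
From mathcomp Require Import ring lra.

Set Implicit Arguments.
Unset Strict Implicit.
Unset Printing Implicit Defensive.

Import Order.TTheory GRing.Theory Num.Theory.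
Import numFieldNormedType.Exports.

Local Open Scope classical_set_scope.
Local Open Scope ring_scope.

(** Why the theorem holds.

    The statement is reduced to a bound on the posterior risk. Write
    D = {b : sq_dist b b0 > M eps_n^2} and let X be the data. For any event A,
    the defining property of the posterior and Markov's inequality give
      E(1_A(X) Pi(D | X)) <= E(1_A(X) sq_dist(b, b0)) / (M eps_n^2),
    where (b, X) follows the Bayesian model. The coordinates of (b, X) are
    independent, so E((b_i - b0_i)^2 | X) is an explicit function g_i(X_i)
    (post_risk), a conjugate computation in dimension one (post_risk_bayes,
    joint_bayes). Hence Pi(D | X) <= sum_i g_i(X_i) / (M eps_n^2) for almost all
    X under the Bayesian marginal of the data.

    The posterior is determined up to null sets of that marginal only, whereas
    the theorem evaluates it under the law of the data at b0. The two are linked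
    by the Cameron-Martin theorem: b and b0 differ by a square-summable sequence
    for almost every b under the prior, and then the laws of the data at b and at
    b0 have the same null sets (obs_null_shift). This is proved by bounding the
    second moment of the likelihood ratio of finitely many levels, uniformly in
    their number, and by approximating an arbitrary event by events that depend
    on finitely many levels (level_dep_approx).

    It remains to bound the expected risk at b0, sum_i E g_i(b0_i + z_i / sqrt n)
    (total_risk_le). Both regimes of p are the case p = 2 for the smoothness
    s' = (alpha - 1) / 2, since a Besov ball lies in a ball of B^{s'}_{2,oo}
    (besov_ball_l2). With a_j^2 of order 2^(- alpha j), a level with
    2^(alpha j) <= n costs per coefficient a noise variance 1 / n, a squared
    shrinkage bias (1 / (n a_j^2))^2 b0_i^2, and a term of order log n / n: the
    spike is preferred only if X_i^2 is of order at most log n / n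
    (integral_post_risk_le_noise). A level with 2^(alpha j) > n costs at most of
    order b0_i^2 + a_j^2 per coefficient (integral_post_risk_le_prior). The sum
    over the levels is geometric on both sides of the critical level
    (sum_profile_le) and is of order log n * n^(- (alpha - 1) / alpha). Since
    eps_n^2 has one more logarithm, Markov's inequality makes the posterior
    probability of D tend to 0, for every M > 0. *)

(** * Integration against densities and image measures *)

Section weighted_law.
Context d d' (T : measurableType d) (U : measurableType d') (R : realType).
Local Open Scope ereal_scope.
Import HBNNSimple.

Lemma exists_density (mu : {measure set T -> \bar R}) (W : T -> \bar R) :
  measurable_fun setT W -> (forall x, 0 <= W x) ->
  exists m : {measure set T -> \bar R},
    forall A, m A = \int[mu]_(x in A) W x.
Proof.
move=> mW W0.
pose m A := \int[mu]_(x in A) W x.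
have m0 : m set0 = 0 by rewrite /m integral_set0.
have mge0 A : 0 <= m A by apply: integral_ge0.
have ms : semi_sigma_additive m.
  move=> A mA tA mUA; rewrite /m ge0_integral_bigcup//; last first.
    exact: measurable_funTS.
  by apply: is_cvg_ereal_nneg_natsum_cond => n _ _; exact: mge0.
pose M := HB.pack_for {measure set T -> \bar R} m
  (isMeasure.Build _ _ _ m m0 mge0 ms).
by exists M.
Qed.

(** Image under X of the measure with density W. Two integrals of the form
    E(W f(X)) are compared by comparing such measures on a generating family. *)
Lemma exists_weighted_law (mu : {measure set T -> \bar R}) (W : T -> \bar R)
    (X : T -> U) :
  measurable_fun setT W -> (forall x, 0 <= W x) -> measurable_fun setT X ->
  exists m : {measure set U -> \bar R},
    (forall A, m A = \int[mu]_(x in X @^-1` A) W x) /\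
    (forall f : U -> \bar R, measurable_fun setT f -> (forall y, 0 <= f y) ->
       \int[m]_y f y = \int[mu]_x (W x * f (X x))).
Proof.
move=> mW W0 mX.
have [m0 m0E] := exists_density mu mW W0.
have [m mE'] : exists m : {measure set U -> \bar R}, forall A, m A = m0 (X @^-1` A).
  by unshelve eexists; [refine (pushforward m0 X : {measure set U -> \bar R})|].
have mE A : m A = \int[mu]_(x in X @^-1` A) W x by rewrite -m0E mE'.
exists m; split => // f mf f0.
pose f_ := nnsfun_approx measurableT mf.
have mWfX g : measurable_fun setT g -> measurable_fun setT (fun x => W x * g (X x)).
  by move=> mg; apply: emeasurable_funM => //; exact: measurableT_comp.
have flim y : (fun n => (f_ n y)%:E) @ \oo --> f y.
  by apply: cvg_nnsfun_approx => // z _; exact: f0.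
transitivity (limn (fun n => \int[m]_y (f_ n y)%:E)).
  rewrite -monotone_convergence//.
  - by apply: eq_integral => y _; apply/esym/cvg_lim.
  - by move=> n; exact/measurable_EFinP.
  - by move=> n y _; rewrite lee_fin.
  - by move=> y _ a b ab; rewrite lee_fin; exact/lefP/nd_nnsfun_approx.
transitivity (limn (fun n => \int[mu]_x (W x * (f_ n (X x))%:E))); last first.
  rewrite -monotone_convergence//.
  - apply: eq_integral => x _; apply/cvg_lim => //.
    have [W0x|Wx0] := eqVneq (W x) 0.
      by rewrite W0x mul0e; under eq_fun do rewrite mul0e; exact: cvg_cst.
    (* for W x = +oo, a positive limit forces f_ n (X x) > 0 eventually *)
    case: (W x) (W0 x) Wx0 => [r|_ _|//].
      by move=> _ _; apply: cvgeZl.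
    have : 0 <= f (X x) by exact: f0.
    rewrite le_eqVlt => /predU1P[fx0|fx0].
      rewrite -fx0 mule0.
      under eq_fun => n.
        rewrite (_ : (f_ n (X x))%:E = 0) ?mule0; last first.
          apply/eqP; rewrite eq_le; apply/andP; split; last by rewrite lee_fin.
          by rewrite fx0 nnsfun_approxE; apply: le_approx => // z _; exact: f0.
        over.
      exact: cvg_cst.
    rewrite gt0_mulye//.
    apply: cvg_near_cst.
    have := flim (X x).
    case: (f (X x)) fx0 => [r r0|_|//].
      move/fine_cvgP => [_] /cvgrPdist_lt /(_ r r0) [N _ HN].
      exists N => // n /= Nn.
      have := HN n Nn; rewrite /= => h.
      rewrite gt0_mulye// lte_fin.
      by move: h; rewrite ltr_norml => /andP[_]; rewrite ltrBlDr -ltrBlDl subrr.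
    move/cvgeyPgt => /(_ 0%R) [N _ HN].
    by exists N => // n /= Nn; rewrite gt0_mulye//; exact: HN.
  - by move=> n; apply: (mWfX (fun z => (f_ n z)%:E)); exact/measurable_EFinP.
  - by move=> n x _; apply: mule_ge0 => //; rewrite lee_fin.
  - move=> x _ a b ab; apply: lee_wpmul2l => //; rewrite lee_fin.
    exact/lefP/nd_nnsfun_approx.
apply: congr_lim; apply/funext => n.
transitivity (\sum_(k \in range (f_ n))
    \int[m]_y (k * \1_(f_ n @^-1` [set k]) y)%:E).
  under eq_integral do rewrite fimfunE -fsumEFin//.
  rewrite ge0_integral_fsum//.
  - by move=> y; exact/measurable_EFinP/measurable_funM.
  - by move=> y x _; rewrite nnfun_muleindic_ge0.
transitivity (\sum_(k \in range (f_ n))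
    \int[mu]_x (W x * (k * \1_(f_ n @^-1` [set k]) (X x))%:E)); last first.
  rewrite [RHS](eq_integral (fun x => \sum_(k \in range (f_ n))
      W x * (k * \1_(f_ n @^-1` [set k]) (X x))%:E)); last first.
    move=> x _; rewrite fimfunE -fsumEFin// ge0_mule_fsumr// => r.
    by rewrite nnfun_muleindic_ge0.
  rewrite ge0_integral_fsum//.
  - move=> y; apply: (mWfX (fun z => (y * \1_(f_ n @^-1` [set y]) z)%:E)).
    exact/measurable_EFinP/measurable_funM.
  - by move=> y x _; apply: mule_ge0 => //; rewrite nnfun_muleindic_ge0.
apply: eq_fsbigr => k _.
rewrite integralZl_indic_nnsfun// integral_indic// setIT mE.
have [k0|k0] := ltP k 0%R.
  rewrite preimage_nnfun0// preimage_set0 integral_set0 mule0.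
  by under eq_integral do rewrite indic0 mulr0 mule0; rewrite integral0.
under [RHS]eq_integral do rewrite EFinM muleCA.
rewrite ge0_integralZl//; last first.
- by move=> x _; apply: mule_ge0.
- apply: (mWfX (fun z => (\1_(f_ n @^-1` [set k]) z)%:E)).
  exact/measurable_EFinP.
congr (_ * _); rewrite integral_mkcond; apply: eq_integral => x _.
by rewrite epatch_indic.
Qed.

End weighted_law.
(** * Independent real random variables *)

Section independence.
Context d (T : measurableType d) (R : realType).
Local Open Scope ereal_scope.

Lemma probability_integral_cst (P : probability T R) (k : \bar R) :
  \int[P]_x k = k.
Proof.
transitivity (k * P setT); first exact: integral_cst.
by rewrite probability_setT mule1.
Qed.

Lemma integral_has_law (P : probability T R) (X : T -> R)
    (m : {measure set (measurableTypeR R) -> \bar R}) (f : R -> \bar R) :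
  measurable_fun setT X -> has_law P X m ->
  measurable_fun setT f -> (forall y, 0 <= f y) ->
  \int[P]_x f (X x) = \int[m]_y f y.
Proof.
move=> mX lawX mf f0.
have [mu [muE mu_int]] :=
  exists_weighted_law (U := measurableTypeR R) P (measurable_cst 1) (fun=> lee01) mX.
transitivity (\int[mu]_y f y).
  by rewrite mu_int//; under [RHS]eq_integral do rewrite mul1e.
apply: eq_measure_integral => A mA _; rewrite muE -lawX// integral_cst ?mul1e//.
by rewrite -[X in measurable X]setTI; exact: mX.
Qed.

Lemma measurable_prode (I : eqType) (s : seq I) (g : I -> T -> \bar R) :
  (forall i, measurable_fun setT (g i)) ->
  measurable_fun setT (fun x => \prod_(i <- s) g i x).
Proof.
move=> mg; elim: s => [|i s ih].
  by under eq_fun do rewrite big_nil; exact: measurable_cst.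
by under eq_fun do rewrite big_cons; exact: emeasurable_funM.
Qed.

(** Independence is a statement on indicators, which are replaced one at a time
    by general factors: for fixed other factors W, the measure
    C |-> E(W 1(X i in C)) is a multiple of the law of X i, hence so are the
    integrals of nonnegative functions. *)
Lemma mutually_independent_integral (I : eqType) (P : probability T R)
    (X : I -> T -> R) (f : I -> R -> \bar R) (s : seq I) :
  (forall i, measurable_fun setT (X i)) -> mutually_independent P X ->
  (forall i, measurable_fun setT (f i)) -> (forall i y, 0 <= f i y) ->
  uniq s ->
  \int[P]_x \prod_(i <- s) f i (X i x) = \prod_(i <- s) \int[P]_x f i (X i x).
Proof.
move=> mX indX mf f0 us.
have mXA i A : measurable A -> measurable (X i @^-1` A).
  by move=> mA; rewrite -[X in measurable X]setTI; exact: mX.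
pose B (s2 : seq I) (A : I -> set R) := \bigcap_(i in [set` s2]) (X i @^-1` A i).
have mB s2 A : (forall i, measurable (A i)) -> measurable (B s2 A).
  move=> mA; rewrite /B; apply: fin_bigcap_measurable => // i _; exact: mXA.
(* s1 carries the general factors and s2 the indicators *)
suff H s1 s2 A : uniq (s1 ++ s2) -> (forall i, measurable (A i)) ->
    \int[P]_(x in B s2 A) \prod_(i <- s1) f i (X i x) =
    (\prod_(i <- s1) \int[P]_x f i (X i x)) * \prod_(i <- s2) P (X i @^-1` A i).
  have := H s [::] (fun=> setT); rewrite cats0 => /(_ us (fun=> measurableT)).
  rewrite big_nil mule1 => <-; congr (integral _ _ _).
  by apply/esym/seteqP; split.
elim: s1 s2 A => [|i s1 ih] s2 A /= us2 mA.
  under eq_integral do rewrite big_nil.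
  rewrite integral_cst ?mul1e; last exact: mB.
  by rewrite big_nil mul1e; apply: indX.
pose W x := \prod_(j <- s1) f j (X j x) * (\1_(B s2 A) x)%:E.
have mp : measurable_fun setT (fun x => \prod_(j <- s1) f j (X j x)).
  by apply: measurable_prode => j; exact: measurableT_comp.
have p0 x : 0 <= \prod_(j <- s1) f j (X j x) by exact: prode_ge0.
have mW : measurable_fun setT W.
  apply: emeasurable_funM => //.
  by apply/measurable_EFinP; exact: measurable_indic (mB _ _ mA).
have W0 x : 0 <= W x by apply: mule_ge0 => //; rewrite lee_fin.
pose c := (\prod_(j <- s1) \int[P]_x f j (X j x)) * \prod_(j <- s2) P (X j @^-1` A j).
have c0 : 0 <= c.
  by apply: mule_ge0; apply: prode_ge0 => j _ //; exact: integral_ge0.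
have [m [mE m_int]] :=
  exists_weighted_law P mW W0 (mX i).
have [m' [m'E m'_int]] :=
  exists_weighted_law P (measurable_cst c) (fun=> c0) (mX i).
have mm' C : measurable C -> m C = m' C.
  move=> mC; rewrite mE m'E integral_cst; last exact: mXA.
  pose A' j := if j == i then C else A j.
  have mA' j : measurable (A' j) by rewrite /A'; case: ifP.
  have BE : B (i :: s2) A' = X i @^-1` C `&` B s2 A.
    apply/seteqP; split => x /=.
      move=> Bx; split; first by have := Bx i; rewrite /= /A' mem_head eqxx; exact.
      move=> j /= js2; have := Bx j; rewrite /= inE js2 orbT /A' => /(_ isT).
      case: eqP => // ji; move: us2; rewrite -ji mem_cat js2 orbT//.
    move=> [Cx Bx] j /=; rewrite inE /A'; case: eqP => [->//|_ /= js2].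
    exact: Bx.
  transitivity (\int[P]_(x in B (i :: s2) A') \prod_(j <- s1) f j (X j x)).
    rewrite BE [RHS]integral_mkcondr; apply: eq_integral => x _.
    by rewrite /W epatch_indic.
  rewrite ih//; last first.
    by rewrite -[i :: s2]cat1s uniq_catCA.
  rewrite big_cons {1}/A' eqxx /c -muleA [_ * P _]muleC; congr (_ * (_ * _)).
  rewrite big_seq [RHS]big_seq; apply: eq_bigr => j js2; rewrite /A'.
  case: eqP => // ji; move: us2; rewrite -ji mem_cat js2 orbT//.
transitivity (\int[m]_y f i y).
  rewrite m_int// [LHS]integral_mkcond; apply: eq_integral => x _.
  by rewrite epatch_indic big_cons /W -muleA muleC.
rewrite (eq_measure_integral m') => [|C mC _]; last exact: mm'.
rewrite m'_int// ge0_integralZl//; last exact: measurableT_comp.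
by rewrite big_cons /c muleC muleA.
Qed.

End independence.
(** * Measures on arrays of wavelet coefficients *)

Definition levels (N : nat) : seq windex :=
  [seq widx k | j <- iota 0 N, k <- enum 'I_(2 ^ j)].

Lemma mem_levels N i : (i \in levels N) = (tag i < N)%N.
Proof.
apply/allpairsPdep/idP => [[j [k [jN _ ->]]]|iN] /=.
  by move: jN; rewrite mem_iota.
exists (tag i), (tagged i); split; last by case: i iN.
- by rewrite mem_iota.
- by rewrite mem_enum.
Qed.

Lemma levels_uniq N : uniq (levels N).
Proof.
apply: allpairs_uniq_dep; first exact: iota_uniq.
  by move=> j _; exact: enum_uniq.
by move=> [j k] [j' k'] _ _.
Qed.

Lemma big_levels (V : Type) (idx : V) (op : Monoid.law idx) N (F : windex -> V) :
  \big[op/idx]_(i <- levels N) F i =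
  \big[op/idx]_(0 <= j < N) \big[op/idx]_(k < 2 ^ j) F (widx k).
Proof.
rewrite big_allpairs_dep /index_iota subn0; apply: eq_bigr => j _.
by rewrite enumT.
Qed.

Section coefs_measure.
Context {R : realType}.

Lemma measurable_coord (i : windex) :
  measurable_fun setT (fun b : coefs R => b i).
Proof.
move=> _ A mA; rewrite setTI; apply: sub_sigma_algebra.
by exists i, A.
Qed.

Lemma measurable_to_coefs d (T : measurableType d) (X : T -> coefs R) :
  (forall i, measurable_fun setT (fun x => X x i)) -> measurable_fun setT X.
Proof.
move=> mX; apply: (@measurability _ _ T (coefs R) setT X (@cylinders R : set (set (coefs R)))).
  by [].
move=> _ [_ [i [A [mA ->]]] <-].
by have := mX i measurableT _ mA.
Qed.

Definition level_rect (N : nat) (A : windex -> set R) : set (coefs R) :=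
  \bigcap_(i in [set` levels N]) [set b | A i (b i)].

Lemma in_level_rect N A (b : coefs R) :
  level_rect N A b <-> forall i, (tag i < N)%N -> A i (b i).
Proof.
split=> [h i iN|h i /=]; first by apply: h; rewrite /= mem_levels.
by rewrite mem_levels; exact: h.
Qed.

Lemma measurable_level_rect N A :
  (forall i, measurable (A i)) -> measurable (level_rect N A).
Proof.
move=> mA; apply: fin_bigcap_measurable => // i _.
by have := measurable_coord i measurableT (mA i); rewrite setTI.
Qed.

Lemma indic_level_rect N A (b : coefs R) :
  (\1_(level_rect N A) b)%:E = (\prod_(i <- levels N) (\1_(A i) (b i) : R)%:E)%E.
Proof.
rewrite /level_rect; elim: (levels N) => [|i s ih].
  by rewrite big_nil indicE mem_set.
rewrite big_cons -ih -EFinM; congr EFin; rewrite !indicE -natrM mulnb.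
congr (nat_of_bool _)%:R; apply/idP/andP.
  rewrite inE => h; rewrite !inE; split; first by apply: h; rewrite /= mem_head.
  by move=> j /= js; apply: h; rewrite /= inE js orbT.
rewrite !inE => -[bi h] j /=; rewrite inE => /predU1P[->//|js].
exact: h.
Qed.

(** Rectangles over all levels below N form a pi-system; N may be taken above any
    N0, which lets the caller assume that a given level is constrained. *)
Lemma coefs_measure_unique (N0 : nat) (m1 m2 : {measure set (coefs R) -> \bar R}) :
  (m1 setT < +oo)%E ->
  (forall N A, (N0 <= N)%N -> (forall i, measurable (A i)) ->
     m1 (level_rect N A) = m2 (level_rect N A)) ->
  forall A, measurable A -> m1 A = m2 A.
Proof.
move=> m1oo m12.
pose G := [set C | exists N A,
  [/\ (N0 <= N)%N, (forall i, measurable (A i)) & C = level_rect N A]].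
move=> A mA; apply: (measure_unique G (fun=> setT)) => //.
- apply/seteqP; split.
    apply: smallest_sub; first exact: smallest_sigma_algebra.
    move=> _ [i [C [mC ->]]]; apply: sub_sigma_algebra.
    exists (maxn N0 (tag i).+1), (fun j => if j == i then C else setT); split.
    - exact: leq_maxl.
    - by move=> j; case: ifP.
    apply/seteqP; split => b; last first.
      by move/in_level_rect => /(_ i (leq_maxr _ _)); rewrite eqxx.
    by move=> bC; apply/in_level_rect => j _; case: eqP => // ->.
  apply: smallest_sub; first exact: sigma_algebra_measurable.
  by move=> _ [N [C [_ mC ->]]]; exact: measurable_level_rect.
- move=> _ _ [N [C [NN0 mC ->]]] [N' [C' [_ mC' ->]]].
  exists (maxn N N'), (fun i => (if (tag i < N)%N then C i else setT) `&`
    (if (tag i < N')%N then C' i else setT)); split.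
  + exact: leq_trans NN0 (leq_maxl _ _).
  + by move=> i; apply: measurableI; case: ifP.
  + apply/seteqP; split => b.
    move=> [/in_level_rect bC /in_level_rect bC']; apply/in_level_rect => i _.
    by split; case: ifP => // iN; [exact: bC|exact: bC'].
  move/in_level_rect => bCC'; split; apply/in_level_rect => i iN.
    by have [] := bCC' i (leq_trans iN (leq_maxl _ _)); rewrite iN.
  by have [_] := bCC' i (leq_trans iN (leq_maxr _ _)); rewrite iN.
- by move=> _; exists N0, (fun=> setT); split=> //; apply/seteqP; split.
- by rewrite bigcup_const.
- by move=> _ [N [C [NN0 mC ->]]]; exact: m12.
Qed.

Definition level_dep (N : nat) (C : set (coefs R)) : Prop :=
  forall b b' : coefs R, (forall i, (tag i < N)%N -> b i = b' i) -> C b -> C b'.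

(** The events that can be approximated in measure by events depending on
    finitely many levels form a sigma-algebra containing the cylinders. *)
Lemma level_dep_approx (m : {measure set (coefs R) -> \bar R})
    (A : set (coefs R)) (e : R) :
  (m setT < +oo)%E -> measurable A -> 0 < e ->
  exists N C, [/\ measurable C, level_dep N C,
    (m (A `\` C) <= e%:E)%E & (m (C `\` A) <= e%:E)%E].
Proof.
move=> moo mA; move: e.
pose H := [set A : set (coefs R) | measurable A /\ forall e, 0 < e ->
  exists N C, [/\ measurable C, level_dep N C,
    (m (A `\` C) <= e%:E)%E & (m (C `\` A) <= e%:E)%E]].
suff : <<s @cylinders R>> `<=` H by move=> /(_ A mA)[].
have mle A1 A2 (c : \bar R) : measurable A1 -> measurable A2 -> A1 `<=` A2 ->
    (m A2 <= c -> m A1 <= c)%E.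
  by move=> mA1 mA2 A12; apply: le_trans; apply: le_measure; rewrite ?inE.
have mU A1 A2 (e1 e2 : R) : measurable A1 -> measurable A2 ->
    (m A1 <= e1%:E -> m A2 <= e2%:E -> m (A1 `|` A2) <= (e1 + e2)%:E)%E.
  move=> mA1 mA2 h1 h2; apply: le_trans (measureU2 _ _ _) _ => //.
  by rewrite EFinD; exact: leeD.
have H0 : H set0.
  split => // e e0; exists 0%N, set0; split => //.
  - by rewrite set0D measure0 lee_fin ltW.
  - by rewrite set0D measure0 lee_fin ltW.
have HU A1 A2 : H A1 -> H A2 -> H (A1 `|` A2).
  move=> [mA1 h1] [mA2 h2]; split; first exact: measurableU.
  move=> e e0; have e20 : 0 < e / 2 by rewrite divr_gt0.
  have [N1 [C1 [mC1 d1 l1 r1]]] := h1 _ e20.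
  have [N2 [C2 [mC2 d2 l2 r2]]] := h2 _ e20.
  exists (maxn N1 N2), (C1 `|` C2); split; first exact: measurableU.
  - move=> b b' bb' [] Cb; [left; apply: d1 Cb|right; apply: d2 Cb] => i iN;
      apply: bb'; apply: leq_trans iN _; [exact: leq_maxl|exact: leq_maxr].
  - rewrite [e]splitr; apply: mle (mU _ _ _ _ _ _ l1 l2);
      rewrite ?setDE; do ?[apply: measurableI|apply: measurableU|apply: measurableC] => //.
    by move=> b [[]Ab /not_orP[]]; [left|right].
  - rewrite [e]splitr; apply: mle (mU _ _ _ _ _ _ r1 r2);
      rewrite ?setDE; do ?[apply: measurableI|apply: measurableU|apply: measurableC] => //.
    by move=> b [[]Ab /not_orP[]]; [left|right].
apply: smallest_sub; last first.
  move=> _ [i [A' [mA' ->]]]; split.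
    by have := measurable_coord i measurableT mA'; rewrite setTI.
  move=> e e0; exists (tag i).+1, [set b | A' (b i)]; split => //.
  - by have := measurable_coord i measurableT mA'; rewrite setTI.
  - by move=> b b' bb'; rewrite /= bb'.
  - by rewrite setDv measure0 lee_fin ltW.
  - by rewrite setDv measure0 lee_fin ltW.
split => //.
  move=> A1 [mA1 h1]; split; first exact: measurableD.
  move=> e e0; have [N [C [mC dC l r]]] := h1 _ e0.
  exists N, (~` C); split => //; first exact: measurableC.
  - by move=> b b' bb' nCb Cb'; apply: nCb; apply: dC Cb' => i /bb'.
  - by rewrite setTD setDE setCK setIC -setDE.
  - by rewrite setTD setDE setCK setIC -setDE.
move=> F HF; have mF n : measurable (F n : set (coefs R)) by have [] := HF n.
split; first exact: bigcup_measurable.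
move=> e e0; have e20 : 0 < e / 2 by rewrite divr_gt0.
pose U n : set (coefs R) := \big[setU/set0]_(k < n) F k.
have HUn n : H (U n).
  by rewrite /U; elim: n => [|n ih]; [rewrite big_ord0|rewrite big_ord_recr; exact: HU].
pose V : set (coefs R) := \bigcup_k F k.
have mV : measurable V by exact: bigcup_measurable.
have mUn n : measurable (U n) by have [] := HUn n.
have : m (V `\` U n) @[n --> \oo] --> m (\bigcap_n (V `\` U n)).
  apply: nonincreasing_cvg_mu.
  - by apply: le_lt_trans moo; apply: le_measure; rewrite ?inE//; exact: measurableD.
  - by move=> n; exact: measurableD.
  - by apply: bigcapT_measurable => n; exact: measurableD.
  - by move=> a b ab; apply/subsetPset; apply: setDS; exact: subset_bigsetU.
have -> : \bigcap_n (V `\` U n) = set0.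
  apply/seteqP; split => // b h.
  have [[k _ Fkb] _] := h 0%N I.
  have [_] := h k.+1 I; apply; rewrite /U big_ord_recr /=; by right.
rewrite measure0 => /fine_cvgP[_ /cvgrPdist_le/(_ _ e20)[n _ /(_ n (leqnn n))]] /=.
rewrite sub0r normrN => hn.
have {}hn : (m (V `\` U n) <= (e / 2)%:E)%E.
  have fin : m (V `\` U n) \is a fin_num.
    rewrite ge0_fin_numE//; apply: le_lt_trans moo.
    by apply: le_measure; rewrite ?inE//; exact: measurableD.
  rewrite -(fineK fin) lee_fin; apply: le_trans hn.
  by rewrite ler_norm.
have [_ /(_ _ e20)[N [C [mC dC l r]]]] := HUn n.
exists N, C; split => //.
- rewrite [e]splitr; apply: mle (mU _ _ _ _ _ _ hn l);
    do ?[apply: measurableU|apply: measurableD] => //.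
  move=> b [Vb nCb]; have [Ub|nUb] := pselect (U n b); first by right.
  by left.
- have {r} : (m (C `\` U n) <= e%:E)%E.
    by apply: le_trans r _; rewrite lee_fin ler_pdivrMr// ler_peMr ?ler1n// ltW.
  apply: mle; do ?[apply: measurableD] => //.
  apply: setDS; rewrite /U -bigcup_mkord => b [k _ Fkb]; by exists k.
Qed.
End coefs_measure.
(** * Gaussian integrals *)

Section gaussian.
Context {R : realType}.
Notation leb := (@lebesgue_measure R).
Implicit Types (m s t x h : R).

Lemma measurable_affine (a b : R) : measurable_fun setT (fun x : R => a + b * x).
Proof. by apply: measurable_funD => //; exact: measurable_funM. Qed.

Lemma integral_affine (b c : R) (f : R -> \bar R) : 0 < c ->
  measurable_fun setT f -> (forall x, 0 <= f x)%E ->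
  (\int[leb]_x (c%:E * f (b + c * x)%R) = \int[leb]_x f x)%E.
Proof.
move=> c0 mf f0.
have c0' : (0 <= c%:E)%E by rewrite lee_fin ltW.
have [mu [muE mu_int]] :=
  exists_weighted_law (U := measurableTypeR R) leb (measurable_cst c%:E) (fun=> c0') (measurable_affine b c).
rewrite -mu_int//; apply/esym/eq_measure_integral => A mA _.
apply: lebesgue_measure_unique => //= _ [[u v]] _ <-.
rewrite muE/= integral_cst/=; last first.
  by rewrite -[X in measurable X]setTI; exact: (measurable_affine b c).
have -> : (fun x => b + c * x) @^-1` `]u, v] = `](u - b) / c, (v - b) / c]%classic.
  apply/seteqP; split => x /=; rewrite !in_itv/= ltr_pdivrMr// ler_pdivlMr//.
    by rewrite ltrBlDl lerBrDl (mulrC x).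
  by rewrite ltrBlDl lerBrDl (mulrC x).
rewrite !lebesgue_measure_itv/= !lte_fin ltr_pM2r ?invr_gt0// ltrD2r.
case: ifP => _; last by rewrite mule0.
by rewrite -!EFinD -EFinM; congr EFin; field; rewrite gt_eqF.
Qed.

Lemma normal_integral m s (f : R -> \bar R) :
  measurable_fun setT f -> (forall x, 0 <= f x)%E ->
  (\int[normal_prob m s]_x f x = \int[leb]_x ((normal_pdf m s x)%:E * f x))%E.
Proof.
move=> mf f0.
have mW : measurable_fun setT (fun x : R => (normal_pdf m s x)%:E).
  by apply/measurable_EFinP; exact: measurable_normal_pdf.
have W0 x : (0 <= (normal_pdf m s x)%:E)%E by rewrite lee_fin normal_pdf_ge0.
have [mu [muE mu_int]] :=
  exists_weighted_law (U := measurableTypeR R) leb mW W0 (@measurable_id _ _ setT).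
by rewrite -mu_int//; apply: eq_measure_integral => A mA _; rewrite muE.
Qed.

Lemma normal_pdfxE m s x : s != 0 ->
  normal_pdf m s x = normal_peak s * normal_fun m s x.
Proof. by move=> s0; rewrite normal_pdfE. Qed.

Lemma normal_pdf_affine m s x : 0 < s ->
  normal_pdf 0 1 x = s * normal_pdf m s (m + s * x).
Proof.
move=> s0; rewrite !normal_pdfxE ?oner_neq0 ?gt_eqF//.
rewrite /normal_peak /normal_fun mulrA; congr (_ * expR _).
  rewrite expr1n mul1r -mulrnAr sqrtrM ?sqr_ge0// sqrtr_sqr gtr0_norm// invfM.
  by rewrite mulrA divff ?mul1r// gt_eqF.
rewrite subr0 expr1n addrAC subrr add0r; field; by rewrite gt_eqF.
Qed.

Lemma normal_integral_affine m s (f : R -> \bar R) : 0 < s ->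
  measurable_fun setT f -> (forall x, 0 <= f x)%E ->
  (\int[normal_prob 0 1]_x f (m + s * x)%R = \int[normal_prob m s]_x f x)%E.
Proof.
move=> s0 mf f0.
have mfa : measurable_fun setT (fun x => f (m + s * x)).
  by apply: measurableT_comp => //; exact: measurable_affine.
rewrite (normal_integral 0 1 mfa (fun=> f0 _)) (normal_integral m s mf f0).
rewrite -[RHS](@integral_affine m s)//.
- apply: eq_integral => x _.
  by rewrite (normal_pdf_affine m x s0) EFinM muleA.
- apply: emeasurable_funM => //.
  by apply/measurable_EFinP; exact: measurable_normal_pdf.
- by move=> x; apply: mule_ge0 => //; rewrite lee_fin normal_pdf_ge0.
Qed.

(** The one-dimensional Cameron-Martin formula: exp(h x - h^2 / 2) is the density
    of N(h, 1) with respect to N(0, 1). *)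
Lemma normal_integral_shift h (f : R -> \bar R) :
  measurable_fun setT f -> (forall x, 0 <= f x)%E ->
  (\int[normal_prob 0 1]_x (f x * (expR (h * x - h ^+ 2 / 2))%:E) =
   \int[normal_prob 0 1]_x f (h + x)%R)%E.
Proof.
move=> mf f0.
have mE : measurable_fun setT (fun x : R => (expR (h * x - h ^+ 2 / 2))%:E).
  apply/measurable_EFinP; apply: measurableT_comp => //.
  by apply: measurable_funB => //; exact: measurable_funM.
under [RHS]eq_integral do rewrite -[X in (h + X)%R]mul1r.
have mfE : measurable_fun setT (fun x => f x * (expR (h * x - h ^+ 2 / 2))%:E)%E.
  exact: emeasurable_funM.
have fE0 x : (0 <= f x * (expR (h * x - h ^+ 2 / 2))%:E)%E.
  by apply: mule_ge0 => //; rewrite lee_fin expR_ge0.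
rewrite (normal_integral_affine h ltr01 mf f0).
rewrite (normal_integral 0 1 mfE fE0) (normal_integral h 1 mf f0).
apply: eq_integral => x _; rewrite [(f x * _)%E]muleC muleA -EFinM; congr (_%:E * _)%E.
rewrite !normal_pdfxE ?oner_neq0// /normal_fun -mulrA -expRD.
by congr (_ * expR _); rewrite expr1n; field.
Qed.

Lemma normal_integral_cst m s (k : R) :
  (\int[normal_prob m s]_x k%:E = k%:E)%E.
Proof.
have normT : normal_prob m s [set: R] = 1%E by exact: probability_setT.
transitivity (k%:E * normal_prob m s [set: R])%E; first exact: integral_cst.
by rewrite normT mule1.
Qed.

Lemma normal_integral_expR h :
  (\int[normal_prob 0 1]_x (expR (h * x))%:E = (expR (h ^+ 2 / 2))%:E)%E.
Proof.
have := @normal_integral_shift h (fun=> (expR (h ^+ 2 / 2))%:E).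
rewrite normal_integral_cst => <- //.
  by apply: eq_integral => x _; rewrite -EFinM -expRD addrC subrK.
Qed.

(** Conjugacy: prior density times likelihood equals marginal density of the
    observation times posterior density. Here t^2 = a^2 + s^2 is the marginal
    variance and r^2 the posterior variance. *)
Lemma normal_pdf_conjugate s a t r x b : s != 0 -> a != 0 -> t != 0 -> r != 0 ->
  t ^+ 2 = a ^+ 2 + s ^+ 2 -> r ^+ 2 * t ^+ 2 = a ^+ 2 * s ^+ 2 ->
  normal_pdf 0 a b * normal_pdf b s x =
  normal_pdf 0 t x * normal_pdf (a ^+ 2 / t ^+ 2 * x) r b.
Proof.
move=> s0 a0 t0 r0 tE rE; rewrite !normal_pdfxE// /normal_fun.
rewrite mulrACA [RHS]mulrACA -!expRD /normal_peak -!invfM; congr (_^-1 * expR _).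
  have p0 (y : R) : 0 <= y ^+ 2 * pi *+ 2.
    by rewrite mulrn_wge0// mulr_ge0 ?sqr_ge0 ?pi_ge0.
  rewrite -!sqrtrM//; congr Num.sqrt.
  transitivity ((a ^+ 2 * s ^+ 2) * pi ^+ 2 *+ 4); first by ring.
  by rewrite -rE; ring.
have -> : r ^+ 2 = a ^+ 2 * s ^+ 2 / t ^+ 2 by rewrite -rE mulfK// expf_neq0.
have t20 : a ^+ 2 + s ^+ 2 != 0 by rewrite -tE expf_neq0.
by rewrite !tE; field; rewrite ?t20 ?a0 ?s0.
Qed.

Lemma sqr_le_expRD (x : R) : x ^+ 2 <= 2 * (expR x + expR (- x)).
Proof.
wlog x0 : x / 0 <= x => [h|].
  have [/h//|/ltW x0] := leP 0 x.
  by have := h (- x); rewrite oppr_ge0 x0 sqrrN opprK addrC; exact.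
have := @expR_ge1Dxn R x 1 x0; have := expR_ge0 (- x).
by rewrite (_ : 2`!%:R = 2 :> R)//; lra.
Qed.

Lemma expR_half_le2 : expR (2^-1 : R) <= 2.
Proof.
have := expR_ge1Dx (- 2^-1 : R); rewrite expRN.
have e0 := expR_gt0 (2^-1 : R); rewrite -(ler_pM2r e0) mulVf ?gt_eqF//; lra.
Qed.

(** Since x^2 <= 2 (e^x + e^-x), the exponential moments, which the shift
    formula provides, bound the second moment. *)
Lemma normal_second_moment :
  (\int[normal_prob 0 1]_x ((x : R) ^+ 2)%:E <= 8%:E)%E.
Proof.
have me (h : R) : measurable_fun setT (fun x : R => (expR (h * x))%:E).
  by apply/measurable_EFinP; apply: measurableT_comp.
apply: (@le_trans _ _ (\int[normal_prob 0 1]_x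
   (2%:E * ((expR (1 * x))%:E + (expR (- 1 * x))%:E)))%E).
  apply: ge0_le_integral => //.
  - by move=> x _; rewrite lee_fin sqr_ge0.
  - by apply/measurable_EFinP; exact: measurable_funX.
  - by apply: emeasurable_funM; [exact: measurable_cst|exact: (emeasurable_funD (me 1) (me (- 1)))].
  - by move=> x _; rewrite mul1r mulN1r -EFinD -EFinM lee_fin sqr_le_expRD.
rewrite ge0_integralZl//; last first.
- by move=> x _; rewrite -EFinD lee_fin addr_ge0 ?expR_ge0.
- exact: (emeasurable_funD (me 1) (me (- 1))).
rewrite ge0_integralD//; first last.
- exact: (me (- 1)).
- exact: (me 1).
rewrite !normal_integral_expR sqrrN expr1n div1r -EFinD -EFinM lee_fin.
by have := expR_half_le2; lra.
Qed.

Lemma normal_sqr_affine_le m s c : 0 <= s ->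
  (\int[normal_prob 0 1]_x ((m + s * x - c) ^+ 2)%:E <=
   (2 * (m - c) ^+ 2 + 16 * s ^+ 2)%:E)%E.
Proof.
move=> s0; have mx2 : measurable_fun setT (fun x : R => (x ^+ 2)%:E).
  by apply/measurable_EFinP; exact: measurable_funX.
apply: (@le_trans _ _ (\int[normal_prob 0 1]_x
   ((2 * (m - c) ^+ 2)%:E + (2 * s ^+ 2)%:E * (x ^+ 2)%:E))%E).
  apply: ge0_le_integral => //.
  - by move=> x _; rewrite lee_fin sqr_ge0.
  - apply/measurable_EFinP; apply: measurable_funX.
    by apply: measurable_funB => //; exact: measurable_affine.
  - apply: emeasurable_funD => //; exact: emeasurable_funM.
  - move=> x _; rewrite -EFinM -EFinD lee_fin -subr_ge0.
    by rewrite [leRHS](_ : _ = (m - c - s * x) ^+ 2) ?sqr_ge0//; ring.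
have c1 : 0 <= 2 * (m - c) ^+ 2 by rewrite mulr_ge0 ?sqr_ge0.
have c2 : 0 <= 2 * s ^+ 2 by rewrite mulr_ge0 ?sqr_ge0.
have mcx2 : measurable_fun setT (fun x : R => ((2 * s ^+ 2)%:E * (x ^+ 2)%:E)%E).
  exact: emeasurable_funM.
have cx2 (x : R) : (0 <= (2 * s ^+ 2)%:E * (x ^+ 2)%:E)%E.
  by rewrite mule_ge0// lee_fin sqr_ge0.
rewrite ge0_integralD//; do ?[exact: mcx2 | by move=> x _; rewrite lee_fin].
rewrite normal_integral_cst ge0_integralZl//;
  do ?[exact: mx2 | by move=> x _; rewrite lee_fin sqr_ge0].
rewrite EFinD leeD2l// (_ : 16 * s ^+ 2 = 2 * s ^+ 2 * 8); last by ring.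
by rewrite [leRHS]EFinM lee_wpmul2l ?normal_second_moment// lee_fin mulr_ge0 ?sqr_ge0.
Qed.

Lemma normal_sqr_le m s c : 0 < s ->
  (\int[normal_prob m s]_x ((x - c) ^+ 2)%:E <=
   (2 * (m - c) ^+ 2 + 16 * s ^+ 2)%:E)%E.
Proof.
move=> s0; rewrite -(@normal_integral_affine m s)//; last 2 first.
- by apply/measurable_EFinP; apply: measurable_funX; exact: measurable_funB.
- by move=> x; rewrite lee_fin sqr_ge0.
by apply: normal_sqr_affine_le; exact: ltW.
Qed.

End gaussian.
(** * The observations; absolute continuity under square-summable shifts *)

Lemma prod_EFin (R : realType) (I : Type) (s : seq I) (F : I -> R) :
  (\prod_(i <- s) (F i)%:E)%E = (\prod_(i <- s) F i)%:E.
Proof. by rewrite (big_morph EFin (@EFinM R) erefl). Qed.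

Section observations.
Context {R : realType} d (T : measurableType d) (P : probability T R).
Variable z : windex -> {RV P >-> R}.

Lemma measurable_obs n (b : coefs R) : measurable_fun setT (obs z n b).
Proof.
apply: measurable_to_coefs => i; apply: measurable_funD => //.
by apply: measurable_funM => //; exact: measurable_funPT.
Qed.

Lemma measurable_obs_pair n :
  measurable_fun setT (fun x : coefs R * T => obs z n x.1 x.2).
Proof.
apply: measurable_to_coefs => i; apply: measurable_funD.
  exact: (measurableT_comp (f := fun b : coefs R => b i) (measurable_coord i) measurable_fst).
apply: measurable_funM => //.
exact: (measurableT_comp (f := z i) (measurable_funPT (z i)) measurable_snd).
Qed.

Lemma measurable_obs_preimage n (b : coefs R) A : measurable A ->
  measurable (obs z n b @^-1` A).
Proof. by move=> mA; rewrite -[X in measurable X]setTI; exact: measurable_obs. Qed.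

Hypothesis hz : std_gaussian_noise z.

Lemma integral_noise (f : windex -> R -> \bar R) N :
  (forall i, measurable_fun setT (f i)) -> (forall i y, (0 <= f i y)%E) ->
  (\int[P]_x \prod_(i <- levels N) f i (z i x) =
   \prod_(i <- levels N) \int[normal_prob 0 1]_y f i y)%E.
Proof.
move=> mf f0; have mz i : measurable_fun setT (z i) by exact: measurable_funPT.
rewrite (@mutually_independent_integral _ _ _ _ _ (fun i => z i : T -> R))//.
- by apply: eq_bigr => i _; apply: integral_has_law => //; exact: hz.2.
- exact: hz.1.
- exact: levels_uniq.
Qed.

Section cameron_martin.
Variables (n : nat) (n0 : (0 < n)%N) (b b' : coefs R).

Let s := Num.sqrt (n%:R : R).
Let s0 : 0 < s. Proof. by rewrite sqrtr_gt0 ltr0n. Qed.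

Let splice N : coefs R := fun i => if (tag i < N)%N then b' i else b i.

Let h N i := s * (splice N i - b i).

(* likelihood ratio of splice N against b *)
Let lr N omega : R :=
  \prod_(i <- levels N) expR (h N i * z i omega - h N i ^+ 2 / 2).

Let lr_ge0 N omega : 0 <= lr N omega.
Proof. by apply: prodr_ge0 => i _; exact: expR_ge0. Qed.

Let measurable_lr N : measurable_fun setT (lr N).
Proof.
apply: measurable_prod => i _; apply: measurableT_comp => //.
by apply: measurable_funB => //; apply: measurable_funM => //; exact: measurable_funPT.
Qed.

Let lr_levels N N' omega : (N <= N')%N ->
  \prod_(i <- levels N') expR (h N i * z i omega - h N i ^+ 2 / 2) = lr N omega.
Proof.
move=> NN'; rewrite /lr !big_levels (big_cat_nat _ NN')//=.
rewrite [X in _ * X]big_nat_cond [X in _ * X]big1 ?mulr1// => j.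
rewrite andbT => /andP[Nj _]; apply: big1 => k _.
by rewrite /h /splice /= ltnNge Nj subrr mulr0 mul0r expr0n mul0r subr0 expR0.
Qed.

(* Both sides are measures in C, and on rectangles the identity is the
   one-dimensional shift formula in each coordinate. *)
Let splice_prob N C : measurable C ->
  P (obs z n (splice N) @^-1` C) =
  (\int[P]_(omega in obs z n b @^-1` C) (lr N omega)%:E)%E.
Proof.
move=> mC.
have mlr : measurable_fun setT (fun omega => (lr N omega)%:E).
  exact/measurable_EFinP.
have [m1 [m1E m1_int]] :=
  exists_weighted_law P (measurable_cst 1%E) (fun=> lee01) (measurable_obs n (splice N)).
have [m2 [m2E m2_int]] :=
  exists_weighted_law P mlr (fun=> lr_ge0 _ _) (measurable_obs n b).
rewrite -m2E; transitivity (m1 C).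
  by rewrite m1E integral_cst ?mul1e//; exact: measurable_obs_preimage.
apply: (@coefs_measure_unique R N) => //.
  by rewrite m1E preimage_setT probability_integral_cst ltry.
move=> N' A NN' mA.
have mrect := measurable_level_rect N' mA.
have mind : measurable_fun setT (fun b : coefs R => (\1_(level_rect N' A) b)%:E : \bar R).
  by apply/measurable_EFinP; exact: measurable_indic.
have ind0 (c : coefs R) : (0 <= (\1_(level_rect N' A) c)%:E :> \bar R)%E by rewrite lee_fin.
have mE (m : {measure set (coefs R) -> \bar R}) :
    m (level_rect N' A) = (\int[m]_x (\1_(level_rect N' A) x)%:E)%E.
  by rewrite integral_indic// setIT.
have maff (c : R) : measurable_fun setT (fun x : R => c + x / s).
  by apply: measurable_funD => //; exact: measurable_funM.
have mA1 i (c : R) : measurable_fun setT (fun x : R => (\1_(A i) (c + x / s))%:E : \bar R).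
  apply/measurable_EFinP.
  by apply: (measurableT_comp (f := \1_(A i) : R -> R)) => //; exact: measurable_indic.
rewrite !mE m1_int// m2_int//.
under eq_integral do rewrite mul1e indic_level_rect.
rewrite (integral_noise (f := fun i x => (\1_(A i) (splice N i + x / s))%:E))//.
transitivity (\int[P]_x \prod_(i <- levels N') ((\1_(A i) (b i + z i x / s))%:E *
   (expR (h N i * z i x - h N i ^+ 2 / 2))%:E))%E; last first.
  apply: eq_integral => x _; rewrite indic_level_rect -(lr_levels x NN') -prod_EFin.
  by rewrite big_split/= muleC.
rewrite (integral_noise (f := fun i x => ((\1_(A i) (b i + x / s))%:E *
   (expR (h N i * x - h N i ^+ 2 / 2))%:E)%E))//; last first.
- move=> i; apply: emeasurable_funM => //; apply/measurable_EFinP.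
  apply: measurableT_comp => //.
  by apply: measurable_funB => //; exact: measurable_funM.
apply: eq_bigr => i _; rewrite normal_integral_shift//.
apply: eq_integral => x _; congr (\1_(A i) _)%:E.
by rewrite /h mulrDl mulrAC mulfV ?gt_eqF// mul1r addrA subrKC.
Qed.

Hypothesis bb' : (sq_dist b' b < +oo)%E.

Let K := expR (n%:R * fine (sq_dist b' b)).

Let lr_second_moment N : (\int[P]_omega ((lr N omega) ^+ 2)%:E <= K%:E)%E.
Proof.
under eq_integral do rewrite /lr -prodrXl -prod_EFin.
rewrite (integral_noise (f := fun i x => (expR (h N i * x - h N i ^+ 2 / 2) ^+ 2)%:E)).
- rewrite (eq_bigr (fun i => (expR (h N i ^+ 2))%:E)); last first.
    move=> i _.
    transitivity (\int[normal_prob 0 1]_y ((expR (- h N i ^+ 2))%:E *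
        (expR ((2 * h N i) * y))%:E))%E.
      apply: eq_integral => x _; rewrite -EFinM -expRM_natl -expRD.
      by congr (expR _)%:E; field.
    rewrite ge0_integralZl// ?normal_integral_expR//.
    + by rewrite -EFinM -expRD; congr (expR _)%:E; field.
    + by apply/measurable_EFinP; apply: measurableT_comp.
  rewrite prod_EFin lee_fin -expR_sum ler_expR.
  rewrite (eq_bigr (fun i => n%:R * (splice N i - b i) ^+ 2)); last first.
    by move=> i _; rewrite exprMn sqr_sqrtr.
  rewrite -mulr_sumr ler_wpM2l//.
  rewrite -lee_fin fineK; last first.
    by rewrite ge0_fin_numE//; apply: nneseries_ge0 => j _ _; rewrite lee_fin sumr_ge0// => k _; exact: sqr_ge0.
  rewrite big_levels -sumEFin.
  apply: le_trans (nneseries_lim_ge N _) => [|j _ _]; last first.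
    by rewrite lee_fin sumr_ge0// => k _; exact: sqr_ge0.
  rewrite le_eqVlt; apply/orP; left; apply/eqP.
  rewrite big_nat_cond [RHS]big_nat_cond; apply: eq_bigr => j /andP[/andP[_ jN] _].
  by congr EFin; apply: eq_bigr => k _; rewrite /splice /= jN.
- move=> i; apply/measurable_EFinP; apply: measurable_funX.
  apply: measurableT_comp => //.
  by apply: measurable_funB => //; exact: measurable_funM.
- by move=> i y; rewrite lee_fin sqr_ge0.
Qed.

(* l <= t + l^2 / t, applied to the likelihood ratio l *)
Let level_dep_bound N C t : measurable C -> level_dep N C -> 0 < t ->
  (P (obs z n b' @^-1` C) <= t%:E * P (obs z n b @^-1` C) + (K / t)%:E)%E.
Proof.
move=> mC dC t0; have mbC := measurable_obs_preimage n b mC.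
have -> : obs z n b' @^-1` C = obs z n (splice N) @^-1` C.
  by apply/seteqP; split => x; apply: dC => i iN; rewrite /obs /splice iN.
have mlr : measurable_fun setT (lr N) by exact: measurable_lr.
have mlr2 : measurable_fun setT (fun x => ((lr N x) ^+ 2 / t)%:E).
  by apply/measurable_EFinP; apply: measurable_funM => //; exact: measurable_funX.
have lr2_ge0 x : (0 <= ((lr N x) ^+ 2 / t)%:E)%E.
  by rewrite lee_fin divr_ge0 ?sqr_ge0// ltW.
rewrite splice_prob//.
apply: (@le_trans _ _ (\int[P]_(x in obs z n b @^-1` C) (t%:E + ((lr N x) ^+ 2 / t)%:E))%E).
  apply: ge0_le_integral => //.
  - by move=> x _; rewrite lee_fin.
  - by apply/measurable_EFinP; exact: measurable_funTS.
  - by apply: emeasurable_funD => //; exact: measurable_funTS.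
  - move=> x _; rewrite -EFinD lee_fin -(ler_pM2r t0) mulrDl divfK ?gt_eqF//.
    by have := sqr_ge0 (t - lr N x); have := sqr_ge0 (t + lr N x); lra.
rewrite ge0_integralD//; last 2 first.
- by move=> x _; rewrite lee_fin ltW.
- exact: measurable_funTS.
rewrite integral_cst// leeD2l//.
apply: (@le_trans _ _ (\int[P]_x ((lr N x) ^+ 2 / t)%:E)%E).
  by apply: ge0_subset_integral.
under eq_integral do rewrite mulrC EFinM.
rewrite ge0_integralZl//; last 3 first.
- by apply/measurable_EFinP; exact: measurable_funX.
- by move=> x _; rewrite lee_fin sqr_ge0.
- by rewrite lee_fin invr_ge0 ltW.
by rewrite mulrC EFinM lee_wpmul2l// ?lr_second_moment// lee_fin invr_ge0 ltW.
Qed.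

(** Cameron-Martin: the laws of the data at b and at b' have the same null sets.
    An event A that is null at b is approximated, at b and at b' simultaneously,
    by an event C that depends on finitely many levels; then C has probability at
    most e at b, hence at most t e + K / t at b', where K bounds the second moment
    of all the likelihood ratios. Let e tend to 0, then t to infinity. *)
Lemma obs_null_shift A : measurable A ->
  P (obs z n b @^-1` A) = 0%E -> P (obs z n b' @^-1` A) = 0%E.
Proof.
move=> mA A0.
have [m1 [m1E _]] :=
  exists_weighted_law P (measurable_cst 1%E) (fun=> lee01) (measurable_obs n b).
have [m2 [m2E _]] :=
  exists_weighted_law P (measurable_cst 1%E) (fun=> lee01) (measurable_obs n b').
have {}m1E C : measurable C -> m1 C = P (obs z n b @^-1` C).
  by move=> mC; rewrite m1E integral_cst ?mul1e//; exact: measurable_obs_preimage.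
have {}m2E C : measurable C -> m2 C = P (obs z n b' @^-1` C).
  by move=> mC; rewrite m2E integral_cst ?mul1e//; exact: measurable_obs_preimage.
pose m : {measure set (coefs R) -> \bar R} := measure_add m1 m2.
have mE C : m C = (m1 C + m2 C)%E by exact: measure_addE.
have K0 : 0 < K by exact: expR_gt0.
have H t e : 0 < t -> 0 < e ->
    (P (obs z n b' @^-1` A) <= (t * e + K / t + e)%:E)%E.
  move=> t0 e0.
  have [|N [C [mC dC AC CA]]] := @level_dep_approx R m A e _ mA e0.
    by rewrite mE m1E// m2E// !preimage_setT !probability_setT -EFinD ltry.
  have mAC : measurable (A `\` C) by exact: measurableD.
  have mCA : measurable (C `\` A) by exact: measurableD.
  have {}AC : (m2 (A `\` C) <= e%:E)%E.
    by apply: le_trans AC; rewrite mE leeDr.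
  have {}CA : (m1 (C `\` A) <= e%:E)%E.
    by apply: le_trans CA; rewrite mE leeDl.
  have C1 : (m1 C <= e%:E)%E.
    apply: le_trans CA; rewrite (measureDI m1 mC mA).
    rewrite -[leRHS]adde0 leeD2l// -A0 -m1E//.
    by apply: le_measure; rewrite ?inE//; exact: measurableI.
  rewrite -m2E// (measureDI m2 mA mC) addeC EFinD leeD//.
  apply: (@le_trans _ _ (m2 C)).
    by apply: le_measure; rewrite ?inE//; exact: measurableI.
  rewrite m2E//; apply: le_trans (level_dep_bound mC dC t0) _.
  rewrite EFinD; apply: leeD2r; rewrite EFinM; apply: lee_wpmul2l.
    by rewrite lee_fin ltW.
  by rewrite -m1E.
apply/eqP; rewrite eq_le measure_ge0 andbT; apply/lee_addgt0Pr => e e0.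
rewrite add0e; have t0 : 0 < 2 * K / e by rewrite divr_gt0// mulr_gt0.
have t1 : 0 < 2 * K / e + 1 by rewrite addr_gt0.
(* t = 2 K / e makes K / t = e / 2; the other two terms add up to e / 2 *)
have e1 : 0 < e / 2 / (2 * K / e + 1) by rewrite !divr_gt0.
apply: le_trans (H _ _ t0 e1) _; rewrite lee_fin.
rewrite le_eqVlt; apply/orP; left; apply/eqP; field.
by rewrite !gt_eqF//= -?(mulr_gt0 K0)//; nra.
Qed.

End cameron_martin.
End observations.
(** * Posterior risk of one coefficient under the spike and slab prior *)

Section spike_slab_measure.
Context {R : realType}.

Lemma normal_prob_norm (m s : R) A : normal_prob m `|s| A = normal_prob m s A.
Proof.
rewrite /normal_prob; apply: eq_integral => x _; congr EFin.
have [->|s0] := eqVneq s 0; first by rewrite normr0.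
by rewrite !normal_pdfxE ?normr_eq0// /normal_peak /normal_fun real_normK ?num_real.
Qed.

Lemma integral_spike_slab d (T : measurableType d) (P : probability T R)
    (X : T -> R) (w a : R) (f : R -> \bar R) :
  0 <= w <= 1 -> measurable_fun setT X -> has_law P X (spike_slab w a) ->
  measurable_fun setT f -> (forall y, 0 <= f y)%E ->
  (\int[P]_x f (X x) =
   w%:E * \int[normal_prob 0 a]_y f y + (1 - w)%:E * f 0%R)%E.
Proof.
move=> /andP[w0 w1] mX lawX mf f0.
have w1' : 0 <= 1 - w by rewrite subr_ge0.
pose m1 : {measure set (measurableTypeR R) -> \bar R} :=
  mscale (NngNum w0) (normal_prob 0 a).
pose m2 : {measure set (measurableTypeR R) -> \bar R} :=
  mscale (NngNum w1') (\d_(0%R : measurableTypeR R)).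
pose m : {measure set (measurableTypeR R) -> \bar R} := measure_add m1 m2.
have mE A : m A = (m1 A + m2 A)%E by exact: measure_addE.
rewrite (integral_has_law (m := m))//; last first.
  by move=> A mA; rewrite lawX// mE.
rewrite ge0_integral_measure_add// !ge0_integral_mscale//.
by rewrite integral_dirac//= diracT mul1e.
Qed.

End spike_slab_measure.

(** A quantity y that is weighted by at most min(1, Q exp(-y)) contributes at most
    ln Q + 1: below ln Q by the bound 1, above it by u exp(-u) <= 1. *)
Lemma mulr_decay_le (R : realType) (q y Q : R) : 0 <= q <= 1 -> 0 <= y -> 1 <= Q ->
  q <= Q * expR (- y) -> y * q <= ln Q + 1.
Proof.
move=> /andP[q0 q1] y0 Q1 qQ; have Q0 : 0 < Q by exact: lt_le_trans Q1.
have lQ : 0 <= ln Q by exact: ln_ge0.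
have [yQ|Qy] := leP y (ln Q); first by nra.
have qd : q <= expR (- (y - ln Q)).
  by rewrite opprB addrC expRD lnK ?posrE// mulrC.
have : (y - ln Q) * q <= 1.
  apply: (@le_trans _ _ (expR (y - ln Q) * expR (- (y - ln Q)))).
    apply: ler_pM => //; first by rewrite subr_ge0 ltW.
    by apply: le_trans (expR_ge1Dx _); rewrite lerDr.
  by rewrite -expRD subrr expR0.
nra.
Qed.

Lemma gauss_exponents (R : realType) (a s x : R) :
  s != 0 -> a ^+ 2 + s ^+ 2 != 0 ->
  - (a ^+ 2 / (a ^+ 2 + s ^+ 2) * x ^+ 2 / (2 * s ^+ 2)) +
    - x ^+ 2 / ((a ^+ 2 + s ^+ 2) *+ 2) = - x ^+ 2 / (s ^+ 2 *+ 2).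
Proof.
by move=> s0 as0; field; rewrite as0 s0.
Qed.

Section posterior_risk.
Context {R : realType}.
Notation leb := (@lebesgue_measure R).
(* w, a: weight and standard deviation of the slab; s: standard deviation of
   the noise; c: true value of the coefficient. Below, t is the standard
   deviation of an observation of a slab coefficient, and N(tau x, r^2) the
   posterior of such a coefficient given the observation x. *)
Variables (w a s c : R).
Hypotheses (w01 : 0 <= w <= 1) (a0 : 0 < a) (s0 : 0 < s).

Let t := Num.sqrt (a ^+ 2 + s ^+ 2).
Let tau := a ^+ 2 / (a ^+ 2 + s ^+ 2).
Let r := Num.sqrt (tau * s ^+ 2).

Let as0 : 0 < a ^+ 2 + s ^+ 2. Proof. by rewrite addr_gt0 ?exprn_gt0. Qed.
Let tau0 : 0 < tau. Proof. by rewrite divr_gt0 ?exprn_gt0. Qed.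
Let tau1 : tau <= 1.
Proof. by rewrite ler_pdivrMr// mul1r lerDl sqr_ge0. Qed.
Let t0 : 0 < t. Proof. by rewrite sqrtr_gt0. Qed.
Let r0 : 0 < r. Proof. by rewrite sqrtr_gt0 mulr_gt0 ?exprn_gt0. Qed.
Let tE : t ^+ 2 = a ^+ 2 + s ^+ 2. Proof. by rewrite sqr_sqrtr// ltW. Qed.
Let rE : r ^+ 2 = tau * s ^+ 2.
Proof. by rewrite sqr_sqrtr// mulr_ge0 ?sqr_ge0// ltW. Qed.

(* expectation of (beta - c)^2 for beta distributed as N(tau x, r^2) *)
Let slab_risk (x : R) : \bar R :=
  (\int[normal_prob 0 1]_y ((tau * x + r * y - c) ^+ 2)%:E)%E.

(* the densities at x of the observation of a slab and of a spike coefficient,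
   with their prior weights *)
Let slab x := w * normal_pdf 0 t x.
Let spike x := (1 - w) * normal_pdf 0 s x.

(** The posterior expectation of (beta - c)^2 given the observation x. *)
Definition post_risk (x : R) : R :=
  (slab x * fine (slab_risk x) + spike x * c ^+ 2) / (slab x + spike x).

Let slab_risk_ge0 x : (0 <= slab_risk x)%E.
Proof. by apply: integral_ge0 => y _; rewrite lee_fin sqr_ge0. Qed.

Let slab_risk_le x : (slab_risk x <= (2 * (tau * x - c) ^+ 2 + 16 * r ^+ 2)%:E)%E.
Proof. by apply: normal_sqr_affine_le; exact: ltW. Qed.

Let slab_risk_fin x : slab_risk x \is a fin_num.
Proof.
by rewrite ge0_fin_numE//; apply: le_lt_trans (slab_risk_le x) _; rewrite ltry.
Qed.

Let measurable_slab_risk : measurable_fun setT slab_risk.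
Proof.
apply: (@measurable_fun_fubini_tonelli_F _ _ _ _ R (normal_prob 0 1)
  (fun z : R * R => ((tau * z.1 + r * z.2 - c) ^+ 2)%:E)).
  apply/measurable_EFinP; apply: measurable_funX; apply: measurable_funB => //.
  by apply: measurable_funD; apply: measurable_funM => //.
by move=> z; rewrite lee_fin sqr_ge0.
Qed.

Let slab_ge0 x : 0 <= slab x.
Proof. by case/andP: w01 => ? _; rewrite mulr_ge0 ?normal_pdf_ge0. Qed.

Let spike_ge0 x : 0 <= spike x.
Proof. by case/andP: w01 => _ ?; rewrite mulr_ge0 ?normal_pdf_ge0 ?subr_ge0. Qed.

Let pdf_gt0 (m u x : R) : 0 < u -> 0 < normal_pdf m u x.
Proof.
move=> u0; rewrite normal_pdfxE ?gt_eqF// mulr_gt0 ?expR_gt0//.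
by rewrite normal_peak_gt0 ?gt_eqF.
Qed.

Let marginal_gt0 (x : R) : 0 < slab x + spike x.
Proof.
have p1 := pdf_gt0 0 x t0; have p2 := pdf_gt0 0 x s0.
case/andP: w01 => w0; rewrite le_eqVlt => /predU1P[w1|w1].
  by rewrite /slab /spike w1 subrr mul0r addr0 mul1r.
by apply: ltr_wpDl => //; rewrite mulr_gt0// subr_gt0.
Qed.

Let measurable_slab : measurable_fun setT slab.
Proof. by apply: measurable_funM => //; exact: measurable_normal_pdf. Qed.

Let measurable_spike : measurable_fun setT spike.
Proof. by apply: measurable_funM => //; exact: measurable_normal_pdf. Qed.

Lemma post_risk_ge0 (x : R) : 0 <= post_risk x.
Proof.
apply: divr_ge0; last exact: ltW.
by rewrite addr_ge0// mulr_ge0 ?sqr_ge0// fine_ge0.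
Qed.

Lemma measurable_post_risk : measurable_fun setT post_risk.
Proof.
have mf : measurable_fun setT (fine \o slab_risk) by exact: measurableT_comp.
have powE : (fun x => (slab x + spike x)^-1) =
    (fun x => (slab x + spike x) `^ (- 1)).
  by apply/funext => x; rewrite powR_inv1// ltW.
apply: measurable_funM.
  by apply: measurable_funD; apply: measurable_funM.
rewrite powE; apply: (measurableT_comp (measurable_powR (- 1))).
exact: measurable_funD.
Qed.

Let slab_joint (u F : R -> \bar R) :
  measurable_fun setT u -> (forall x, 0 <= u x)%E ->
  measurable_fun setT F -> (forall x, 0 <= F x)%E ->
  (\int[normal_prob 0 a]_b (u b * \int[normal_prob 0 1]_y F (b + s * y)%R) =
   \int[leb]_x (F x * (normal_pdf 0 t x)%:E *
     \int[normal_prob 0 1]_y u (tau * x + r * y)%R))%E.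
Proof.
move=> mu u0 mF F0.
have mFs b : measurable_fun setT (fun y => F (b + s * y)).
  by apply: measurableT_comp => //; exact: measurable_affine.
have mpdf m k : measurable_fun setT (fun x : R => (normal_pdf m k x)%:E).
  by apply/measurable_EFinP; exact: measurable_normal_pdf.
have pdf0 m k x : (0 <= (normal_pdf m k x)%:E :> \bar R)%E.
  by rewrite lee_fin normal_pdf_ge0.
pose J (z : R * R) := ((normal_pdf 0 a z.1 * normal_pdf z.1 s z.2)%:E * u z.1 * F z.2)%E.
have mJ : measurable_fun setT J.
  apply: emeasurable_funM; last exact: measurableT_comp.
  apply: emeasurable_funM; last exact: measurableT_comp.
  apply/measurable_EFinP; apply: measurable_funM.
    by apply: measurableT_comp => //; exact: measurable_normal_pdf.
  under eq_fun do rewrite normal_pdfxE ?gt_eqF// /normal_fun.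
  apply: measurable_funM => //; apply: measurableT_comp => //.
  apply: measurable_funM => //; apply: measurableT_comp => //.
  by apply: measurable_funX; exact: measurable_funB.
have J0 z : (0 <= J z)%E.
  by rewrite !mule_ge0// lee_fin mulr_ge0 ?normal_pdf_ge0.
have mI : measurable_fun setT (fun b => (u b * \int[normal_prob 0 1]_y F (b + s * y)%R)%E).
  apply: emeasurable_funM => //.
  apply: (@measurable_fun_fubini_tonelli_F _ _ _ _ R (normal_prob 0 1)
    (fun z : R * R => F (z.1 + s * z.2))) => [|//].
  apply: measurableT_comp => //; apply: measurable_funD => //.
  exact: measurable_funM.
have I0 b : (0 <= u b * \int[normal_prob 0 1]_y F (b + s * y)%R)%E.
  by rewrite mule_ge0// integral_ge0.
rewrite (normal_integral 0 a mI I0).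
transitivity (\int[leb]_b \int[leb]_x J (b, x))%E.
  apply: eq_integral => b _.
  rewrite (normal_integral_affine b s0 mF F0) (normal_integral b s mF F0).
  rewrite muleA -ge0_integralZl//.
  - by apply: eq_integral => x _; rewrite /J/= EFinM !muleA; congr (_ * _)%E; rewrite muleAC.
  - exact: (emeasurable_funM (mpdf b s) mF).
  - by move=> x _; rewrite mule_ge0.
  - by rewrite mule_ge0.
rewrite (@fubini_tonelli _ _ _ _ R leb leb J mJ J0)//.
apply: eq_integral => x _.
rewrite (normal_integral_affine (tau * x) r0 mu u0) (normal_integral (tau * x) r mu u0).
rewrite -ge0_integralZl//.
- apply: eq_integral => b _; rewrite /J/=.
  rewrite (@normal_pdf_conjugate _ s a t r) ?gt_eqF//.
    by rewrite tE -/tau EFinM [LHS]muleC !muleA.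
  by rewrite rE tE /tau; field; rewrite gt_eqF.
- exact: (emeasurable_funM (mpdf (tau * x) r) mu).
- by move=> b _; rewrite mule_ge0.
- by rewrite mule_ge0.
Qed.

(** Bayes' formula for one coefficient: E(F(X) (beta - c)^2) = E(F(X) g(X)), with
    g the posterior risk. Integrated against Lebesgue measure, both sides have
    the density F(x) (slab x * slab_risk x + spike x * c^2). *)
Lemma post_risk_bayes (F : R -> R) :
  measurable_fun setT F -> (forall x, 0 <= F x) ->
  let I (u : R -> \bar R) (G : R -> \bar R) b :=
    (u b * \int[normal_prob 0 1]_y G (b + s * y)%R)%E in
  let sq b := ((b - c) ^+ 2)%:E in
  let Fg x := (F x * post_risk x)%:E in
  (w%:E * \int[normal_prob 0 a]_b I sq (EFin \o F) b + (1 - w)%:E * I sq (EFin \o F) 0%R =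
   w%:E * \int[normal_prob 0 a]_b I (cst 1) Fg b + (1 - w)%:E * I (cst 1) Fg 0%R)%E.
Proof.
move=> mF F0 I sq Fg; have /andP[w0 w1] := w01.
have mFg : measurable_fun setT Fg.
  apply/measurable_EFinP; apply: measurable_funM => //.
  exact: measurable_post_risk.
have Fg0 x : (0 <= Fg x)%E by rewrite lee_fin mulr_ge0// post_risk_ge0.
have mEF : measurable_fun setT (EFin \o F) by exact/measurable_EFinP.
have EF0 x : (0 <= (EFin \o F) x)%E by rewrite lee_fin.
have msq : measurable_fun setT sq.
  by apply/measurable_EFinP; apply: measurable_funX; exact: measurable_funB.
have sq0 x : (0 <= sq x)%E by rewrite lee_fin sqr_ge0.
have mpdf m k : measurable_fun setT (fun x : R => (normal_pdf m k x)%:E).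
  by apply/measurable_EFinP; exact: measurable_normal_pdf.
have pdf0 m k x : (0 <= (normal_pdf m k x)%:E :> \bar R)%E.
  by rewrite lee_fin normal_pdf_ge0.
have I0E u G : measurable_fun setT G -> (forall x, 0 <= G x)%E -> (0 <= u 0%R)%E ->
    (I u G 0%R = \int[leb]_x (G x * (normal_pdf 0 s x)%:E * u 0%R))%E.
  move=> mG G0 u0; rewrite /I.
  rewrite (normal_integral_affine 0 s0 mG G0) (normal_integral 0 s mG G0) muleC.
  rewrite -ge0_integralZr//.
  - by apply: eq_integral => x _; rewrite [(_%:E * G x)%E]muleC.
  - exact: (emeasurable_funM (mpdf 0 s) mG).
  - by move=> x _; rewrite mule_ge0.
rewrite (slab_joint msq sq0 mEF EF0).
rewrite (slab_joint (measurable_cst 1%E) (fun=> lee01) mFg Fg0).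
rewrite (I0E sq (EFin \o F))// (I0E (cst 1%E) Fg)//.
have mix (k1 k2 : R -> \bar R) :
    measurable_fun setT k1 -> (forall x, 0 <= k1 x)%E ->
    measurable_fun setT k2 -> (forall x, 0 <= k2 x)%E ->
    (w%:E * \int[leb]_x k1 x + (1 - w)%:E * \int[leb]_x k2 x =
     \int[leb]_x (w%:E * k1 x + (1 - w)%:E * k2 x))%E.
  move=> mk1 k10 mk2 k20.
  have w1' : (0 <= (1 - w)%:E)%E by rewrite lee_fin subr_ge0.
  rewrite ge0_integralD//.
  - by rewrite !ge0_integralZl.
  - by move=> x _; rewrite mule_ge0.
  - exact: emeasurable_funM.
  - by move=> x _; rewrite mule_ge0.
  - exact: emeasurable_funM.
have msr : measurable_fun setT (fun x => \int[normal_prob 0 1]_y sq (tau * x + r * y)%R)%E.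
  exact: measurable_slab_risk.
have mprod k G H : measurable_fun setT G -> measurable_fun setT H ->
    measurable_fun setT (fun x : R => G x * (normal_pdf 0 k x)%:E * H x)%E.
  by move=> mG mH; exact: emeasurable_funM (emeasurable_funM mG (mpdf 0 k)) mH.
have mc1 : measurable_fun setT (fun x : R =>
    \int[normal_prob 0 1]_y cst 1%E (tau * x + r * y)%R)%E.
  rewrite (_ : (fun _ => _) = cst 1%E)//.
  by apply/funext => x; exact: normal_integral_cst.
have ppos k G H : (forall x, 0 <= G x)%E -> (forall x, 0 <= H x)%E ->
    forall x : R, (0 <= G x * (normal_pdf 0 k x)%:E * H x)%E.
  by move=> G0 H0 x; rewrite !mule_ge0.
have sr0 x : (0 <= \int[normal_prob 0 1]_y sq (tau * x + r * y)%R)%E.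
  by apply: integral_ge0.
have c10 (x : R) : (0 <= \int[normal_prob 0 1]_y cst 1%E (tau * x + r * y)%R)%E.
  by apply: integral_ge0.
have sq00 (x : R) : (0 <= cst (sq 0%R) x)%E by exact: sq0.
rewrite (mix _ _ (mprod t _ _ mEF msr) (ppos t _ _ EF0 sr0)
  (mprod s _ _ mEF (measurable_cst (sq 0%R))) (ppos s _ _ EF0 sq00)).
rewrite (mix _ _ (mprod t _ _ mFg mc1) (ppos t _ _ Fg0 c10)
  (mprod s _ _ mFg (measurable_cst 1%E)) (ppos s _ _ Fg0 (fun=> lee01))).
- apply: eq_integral => x _.
  have -> : (\int[normal_prob 0 1]_y cst 1%E (tau * x + r * y)%R = 1)%E.
    exact: normal_integral_cst.
  rewrite !mule1 /Fg -/(slab_risk x).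
  rewrite -(fineK (slab_risk_fin x)) /sq sub0r sqrrN.
  rewrite /= -!EFinM -!EFinD; congr EFin.
  have := marginal_gt0 x; rewrite /post_risk /slab /spike => m0.
  by field; rewrite gt_eqF.
Qed.
(* posterior probability of the spike *)
Let spike_prob x := spike x / (slab x + spike x).

Let spike_prob_ge0 x : 0 <= spike_prob x. Proof. by rewrite divr_ge0// ltW. Qed.

Let spike_prob_le1 x : spike_prob x <= 1.
Proof. by rewrite ler_pdivrMr// mul1r lerDr. Qed.

Let post_risk_le x :
  post_risk x <= 2 * (tau * x - c) ^+ 2 + 16 * r ^+ 2 + spike_prob x * c ^+ 2.
Proof.
have V0 : 0 <= fine (slab_risk x) by rewrite fine_ge0.
have V1 : fine (slab_risk x) <= 2 * (tau * x - c) ^+ 2 + 16 * r ^+ 2.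
  by rewrite -lee_fin fineK.
have -> : post_risk x =
    slab x / (slab x + spike x) * fine (slab_risk x) + spike_prob x * c ^+ 2.
  by rewrite /post_risk /spike_prob; field; rewrite gt_eqF.
rewrite lerD2r; apply: le_trans V1; rewrite ler_piMl//.
by rewrite ler_pdivrMr// mul1r lerDl.
Qed.

(* D + E y^2 bounds the loss due to the spike at the observation c + s y. *)
Let integral_post_risk_le (D E : R) : 0 <= D -> 0 <= E ->
  (forall y, spike_prob (c + s * y) * c ^+ 2 <= D + E * y ^+ 2) ->
  (\int[normal_prob 0 1]_y (post_risk (c + s * y))%:E <=
   (4 * (tau * c - c) ^+ 2 + 48 * tau * s ^+ 2 + D + 8 * E)%:E)%E.
Proof.
move=> D0 E0 spike_probE.
have msq : measurable_fun setT (fun y : R => ((tau * c + tau * s * y - c) ^+ 2)%:E).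
  apply/measurable_EFinP; apply: measurable_funX; apply: measurable_funB => //.
  exact: measurable_affine.
have my2 : measurable_fun setT (fun y : R => (y ^+ 2)%:E).
  by apply/measurable_EFinP; exact: measurable_funX.
have sq0 (y : R) : (0 <= ((tau * c + tau * s * y - c) ^+ 2)%:E :> \bar R)%E.
  by rewrite lee_fin sqr_ge0.
have y20 (y : R) : (0 <= (y ^+ 2)%:E :> \bar R)%E by rewrite lee_fin sqr_ge0.
have m1 : measurable_fun setT (fun y : R => 2%:E * ((tau * c + tau * s * y - c) ^+ 2)%:E)%E.
  exact: emeasurable_funM (measurable_cst _) msq.
have m2 : measurable_fun setT (fun y : R => E%:E * (y ^+ 2)%:E)%E.
  exact: emeasurable_funM (measurable_cst _) my2.
have m3 : measurable_fun setT (fun y : R => (16 * r ^+ 2 + D)%:E + E%:E * (y ^+ 2)%:E)%E.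
  exact: emeasurable_funD (measurable_cst _) m2.
have k0 : 0 <= 16 * r ^+ 2 + D by rewrite addr_ge0// mulr_ge0 ?sqr_ge0.
have p1 (y : R) : (0 <= 2%:E * ((tau * c + tau * s * y - c) ^+ 2)%:E :> \bar R)%E.
  by rewrite mule_ge0// lee_fin.
have p2 (y : R) : (0 <= E%:E * (y ^+ 2)%:E :> \bar R)%E.
  by rewrite mule_ge0// lee_fin.
have p3 (y : R) : (0 <= (16 * r ^+ 2 + D)%:E + E%:E * (y ^+ 2)%:E :> \bar R)%E.
  by rewrite adde_ge0// lee_fin.
apply: (@le_trans _ _ (\int[normal_prob 0 1]_y
   (2%:E * ((tau * c + tau * s * y - c) ^+ 2)%:E +
    ((16 * r ^+ 2 + D)%:E + E%:E * (y ^+ 2)%:E)))%E).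
  apply: ge0_le_integral => //.
  - by move=> y _; rewrite lee_fin post_risk_ge0.
  - apply/measurable_EFinP; apply: (measurableT_comp measurable_post_risk).
    exact: measurable_affine.
  - exact: emeasurable_funD m1 m3.
  - move=> y _; rewrite -!EFinM -!EFinD lee_fin.
    apply: le_trans (post_risk_le _) _; have := spike_probE y.
    by rewrite mulrDr mulrA; lra.
rewrite ge0_integralD//.
rewrite ge0_integralZl// ge0_integralD// normal_integral_cst ge0_integralZl//;
  do ?[exact: m1|exact: m2|exact: m3|exact: msq|exact: my2].
have hsq := @normal_sqr_affine_le R (tau * c) (tau * s) c (ltW (mulr_gt0 tau0 s0)).
have hy2 := @normal_second_moment R.
have tau2 : tau ^+ 2 <= tau by rewrite expr2 ler_piMl// ltW.
apply: (@le_trans _ _ (2%:E * (2 * (tau * c - c) ^+ 2 + 16 * (tau * s) ^+ 2)%:E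
  + ((16 * r ^+ 2 + D)%:E + E%:E * 8%:E))%E).
  apply: leeD; first exact: lee_wpmul2l.
  by apply: leeD2l; apply: lee_wpmul2l; rewrite ?lee_fin.
rewrite -!EFinM -!EFinD lee_fin rE exprMn.
have : tau ^+ 2 * s ^+ 2 <= tau * s ^+ 2 by rewrite ler_wpM2r ?sqr_ge0.
lra.
Qed.

(** The bound for high resolution levels: no gain from the data is claimed, and
    the risk is at most of the order of c^2 plus the prior variance. *)
Lemma integral_post_risk_le_prior :
  (\int[normal_prob 0 1]_y (post_risk (c + s * y))%:E <=
   (5 * c ^+ 2 + 48 * a ^+ 2)%:E)%E.
Proof.
apply: le_trans (@integral_post_risk_le (c ^+ 2) 0 _ _ _) _ => //.
- exact: sqr_ge0.
- by move=> y; rewrite mul0r addr0 ler_piMl ?sqr_ge0.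
rewrite lee_fin.
have tc : (tau * c - c) ^+ 2 <= c ^+ 2.
  have -> : (tau * c - c) ^+ 2 = (1 - tau) ^+ 2 * c ^+ 2 by ring.
  rewrite ler_piMl ?sqr_ge0//.
  have : 0 <= tau * (2 - tau) by rewrite mulr_ge0 ?ltW// subr_gt0 (le_lt_trans tau1)// ltr1n.
  nra.
have ts : tau * s ^+ 2 <= a ^+ 2.
  by rewrite mulrAC ler_pdivrMr// ler_wpM2l ?sqr_ge0// lerDr sqr_ge0.
lra.
Qed.

Let peak_mul (u : R) : 0 < u -> normal_peak u * u = (Num.sqrt (pi *+ 2))^-1.
Proof.
move=> u0; rewrite /normal_peak -mulrnAr sqrtrM ?sqr_ge0// sqrtr_sqr gtr0_norm//.
by rewrite invfM mulrAC mulVf ?mul1r// gt_eqF.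
Qed.

Let spike_prob_decay (x : R) : 0 < w ->
  spike_prob x <= (1 + a ^+ 2 / s ^+ 2) / w * expR (- (tau * x ^+ 2 / (2 * s ^+ 2))).
Proof.
move=> w0; set Q := _ / w; set e := expR _.
have Qw : Q * w = t ^+ 2 / s ^+ 2.
  rewrite divfK ?gt_eqF// tE; field; by rewrite gt_eqF.
have w1 : 1 - w <= 1 by rewrite lerBlDl lerDr ltW.
have st : s <= t.
  have : s ^+ 2 <= t ^+ 2 by rewrite tE lerDr sqr_ge0.
  by rewrite ler_pXn2r// nnegrE ltW.
have pst : normal_peak s <= t ^+ 2 / s ^+ 2 * normal_peak t.
  have -> : normal_peak s = t / s * normal_peak t.
    apply: (mulIf (lt0r_neq0 s0)); rewrite peak_mul// -(peak_mul t0); field.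
    by rewrite gt_eqF.
  rewrite ler_wpM2r ?normal_peak_ge0// -expr_div_n expr2; apply: ler_peMl.
    by rewrite divr_ge0// ltW.
  by rewrite ler_pdivlMr// mul1r.
have eE : e * normal_fun 0 t x = normal_fun 0 s x.
  by rewrite /e /normal_fun -expRD !subr0 tE gauss_exponents// ?gt_eqF.
have key : spike x <= Q * e * slab x.
  rewrite /spike /slab [leRHS](_ : _ = (Q * w) * e * normal_pdf 0 t x); last by ring.
  rewrite Qw !normal_pdfxE ?gt_eqF//.
  rewrite [leRHS](_ : _ = (t ^+ 2 / s ^+ 2 * normal_peak t) * (e * normal_fun 0 t x)); last by ring.
  rewrite eE mulrA ler_wpM2r ?normal_fun_ge0//; apply: le_trans pst.
  by rewrite ler_piMl ?normal_peak_ge0.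
rewrite ler_pdivrMr//; apply: le_trans key _; rewrite ler_wpM2l ?lerDl//.
by rewrite mulr_ge0 ?expR_ge0// /Q divr_ge0 ?ltW// addr_gt0// divr_gt0 ?exprn_gt0.
Qed.

(** The bound for low resolution levels: shrinkage bias, noise variance, and the
    loss from choosing the spike. The posterior odds of the spike at x are at
    most Q exp(- tau x^2 / (2 s^2)), with Q = (1 + a^2 / s^2) / w, so x^2 times
    the posterior probability of the spike is at most of order s^2 ln Q; passing
    from x^2 to c^2 costs the noise variance. *)
Lemma integral_post_risk_le_noise : 0 < w ->
  (\int[normal_prob 0 1]_y (post_risk (c + s * y))%:E <=
   (4 * (s ^+ 2 / a ^+ 2) ^+ 2 * c ^+ 2 + 64 * s ^+ 2 +
    4 * s ^+ 2 * (1 + s ^+ 2 / a ^+ 2) *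
      (ln ((1 + a ^+ 2 / s ^+ 2) / w) + 1))%:E)%E.
Proof.
move=> w0; set Q := (1 + _) / w.
have Q1 : 1 <= Q.
  rewrite ler_pdivlMr// mul1r; case/andP: w01 => _ /le_trans; apply.
  by rewrite lerDl divr_ge0 ?sqr_ge0.
have lQ0 : 0 <= ln Q by exact: ln_ge0.
have tauE : tau^-1 = 1 + s ^+ 2 / a ^+ 2.
  by rewrite /tau; field; rewrite !gt_eqF.
have k0 : 0 <= 2 * s ^+ 2 * tau^-1.
  by rewrite !mulr_ge0 ?sqr_ge0 ?invr_ge0//; exact: ltW.
have Lx x : x ^+ 2 * spike_prob x <= 2 * s ^+ 2 * tau^-1 * (ln Q + 1).
  have y0 : 0 <= tau * x ^+ 2 / (2 * s ^+ 2).
    apply: divr_ge0; apply: mulr_ge0; rewrite ?sqr_ge0//; exact: ltW.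
  have o01 : 0 <= spike_prob x <= 1 by rewrite spike_prob_ge0 spike_prob_le1.
  have H := mulr_decay_le o01 y0 Q1 (spike_prob_decay x w0).
  have := ler_wpM2l k0 H; apply: le_trans.
  by rewrite le_eqVlt; apply/orP; left; apply/eqP; field; rewrite !gt_eqF.
apply: le_trans (@integral_post_risk_le (2 * (2 * s ^+ 2 * tau^-1 * (ln Q + 1)))
  (2 * s ^+ 2) _ _ _) _.
- by rewrite mulr_ge0// mulr_ge0// addr_ge0.
- by rewrite mulr_ge0 ?sqr_ge0.
- move=> y; have := Lx (c + s * y); have := spike_prob_ge0 (c + s * y).
  have := spike_prob_le1 (c + s * y); set o := spike_prob _; move=> o1 o0 L.
  have : 0 <= o * (c + 2 * s * y) ^+ 2 by rewrite mulr_ge0 ?sqr_ge0.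
  have : o * (s * y) ^+ 2 <= (s * y) ^+ 2 by rewrite ler_piMl ?sqr_ge0.
  by rewrite exprMn => *; lra.
rewrite lee_fin tauE.
have t1 : tau * s ^+ 2 <= s ^+ 2 by rewrite ler_piMl ?sqr_ge0.
have t2 : (tau * c - c) ^+ 2 <= (s ^+ 2 / a ^+ 2) ^+ 2 * c ^+ 2.
  have -> : (tau * c - c) ^+ 2 = (1 - tau) ^+ 2 * c ^+ 2 by ring.
  rewrite ler_wpM2r ?sqr_ge0// ler_pXn2r ?nnegrE ?subr_ge0//; last first.
    by rewrite divr_ge0 ?sqr_ge0.
  have -> : 1 - tau = s ^+ 2 / (a ^+ 2 + s ^+ 2) by rewrite /tau; field; rewrite gt_eqF.
  by rewrite ler_wpM2l ?sqr_ge0// lef_pV2 ?posrE ?exprn_gt0// lerDl sqr_ge0.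
lra.
Qed.

End posterior_risk.
(** * The joint law of the parameter and the data *)

Section joint_law.
Context {R : realType} d (T : measurableType d) (P : probability T R).
Variables (z : windex -> {RV P >-> R}) (hz : std_gaussian_noise z).
Variables (n : nat) (n0 : (0 < n)%N).
Variables (w a : nat -> R) (Pi : probability (coefs R) R).
Hypotheses (w01 : forall j, 0 <= w j <= 1) (a0 : forall j, 0 < a j).
Hypothesis hPi : spike_slab_prior w a Pi.

Let s : R := (Num.sqrt n%:R)^-1.
Let s0 : 0 < s. Proof. by rewrite invr_gt0 sqrtr_gt0 ltr0n. Qed.

Let measurable_smooth (u F : R -> \bar R) :
  measurable_fun setT u -> measurable_fun setT F -> (forall x, 0 <= F x)%E ->
  measurable_fun setT (fun b : R => u b * \int[normal_prob 0 1]_y F (b + s * y)%R)%E.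
Proof.
move=> mu mF F0; apply: emeasurable_funM => //.
apply: (@measurable_fun_fubini_tonelli_F _ _ _ _ R (normal_prob 0 1)
    (fun z : R * R => F (z.1 + s * z.2))) => [|//].
apply: measurableT_comp => //; apply: measurable_funD => //.
exact: measurable_funM.
Qed.

(** Fubini: the noise is integrated out first, for a fixed parameter, by
    independence of the noise variables, and then the parameter, by independence
    of the coordinates under the prior. *)
Lemma joint_integral_prod (U F : windex -> R -> \bar R) N :
  (forall i, measurable_fun setT (U i)) -> (forall i x, (0 <= U i x)%E) ->
  (forall i, measurable_fun setT (F i)) -> (forall i x, (0 <= F i x)%E) ->
  (\int[Pi \x P]_x
     \prod_(i <- levels N) (U i (x.1 i) * F i (obs z n x.1 x.2 i)) =
   \prod_(i <- levels N)
     \int[Pi]_b (U i (b i) * \int[normal_prob 0 1]_y F i (b i + s * y)%R))%E.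
Proof.
move=> mU U0 mF F0.
have mobs i : measurable_fun setT (fun x : coefs R * T => obs z n x.1 x.2 i).
  exact: (measurableT_comp (measurable_coord i) (measurable_obs_pair z n)).
have mprod : measurable_fun setT (fun x : coefs R * T =>
    \prod_(i <- levels N) (U i (x.1 i) * F i (obs z n x.1 x.2 i)))%E.
  apply: measurable_prode => i; apply: emeasurable_funM; last exact: measurableT_comp.
  apply: (measurableT_comp (mU i)).
  exact: (measurableT_comp (measurable_coord i) measurable_fst).
rewrite fubini_tonelli1//; last first.
  by move=> x; apply: prode_ge0 => i _; rewrite mule_ge0.
transitivity (\int[Pi]_b \prod_(i <- levels N)
    (U i (b i) * \int[normal_prob 0 1]_y F i (b i + s * y)%R))%E.
  apply: eq_integral => b _; rewrite /fubini_F/=.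
  transitivity (\int[P]_x \prod_(i <- levels N)
      (U i (b i) * F i (b i + s * z i x)%R))%E.
    by apply: eq_integral => x _; apply: eq_bigr => i _; rewrite /obs [s * _]mulrC.
  have mFi i : measurable_fun setT (fun y : R => F i (b i + s * y)).
    by apply: (measurableT_comp (mF i)); exact: measurable_affine.
  rewrite (integral_noise hz (f := fun i y => U i (b i) * F i (b i + s * y)%R)%E).
  - by apply: eq_bigr => i _; rewrite ge0_integralZl//; exact: mFi.
  - by move=> i; apply: emeasurable_funM => //; exact: mFi.
  - by move=> i y; rewrite mule_ge0.
rewrite (@mutually_independent_integral _ _ _ _ _ (fun i (b : coefs R) => b i)
  (fun i x => U i x * \int[normal_prob 0 1]_y F i (x + s * y)%R)%E)//.
- by move=> i; exact: measurable_coord.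
- exact: hPi.1.
- by move=> i; exact: measurable_smooth.
- by move=> i y; rewrite mule_ge0// integral_ge0.
- exact: levels_uniq.
Qed.

Lemma prior_second_moment i c :
  (\int[Pi]_b ((b i - c) ^+ 2)%:E <= (2 * c ^+ 2 + 16 * a (tag i) ^+ 2)%:E)%E.
Proof.
have msq : measurable_fun setT (fun b : R => ((b - c) ^+ 2)%:E).
  by apply/measurable_EFinP; apply: measurable_funX; exact: measurable_funB.
rewrite (integral_spike_slab (w01 (tag i)) (measurable_coord i) (hPi.2 i) msq)//; last first.
  by move=> y; rewrite lee_fin sqr_ge0.
have /andP[wi0 wi1] := w01 (tag i).
have w1 : 0 <= 1 - w (tag i) by rewrite subr_ge0.
rewrite sub0r sqrrN.
apply: (@le_trans _ _ ((w (tag i))%:E * (2 * (0 - c) ^+ 2 + 16 * a (tag i) ^+ 2)%:E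
    + (1 - w (tag i))%:E * (c ^+ 2)%:E)%E).
  by apply: leeD2r; apply: lee_wpmul2l; [rewrite lee_fin|exact: normal_sqr_le].
rewrite -!EFinM -EFinD lee_fin sub0r sqrrN.
have c2 := sqr_ge0 c; have a2 := sqr_ge0 (a (tag i)).
have : 0 <= (1 - w (tag i)) * (c ^+ 2 + 16 * a (tag i) ^+ 2).
  by rewrite mulr_ge0// addr_ge0// mulr_ge0.
have : 0 <= w (tag i) * (a (tag i) ^+ 2) by rewrite mulr_ge0.
lra.
Qed.

(** Given all the observations, the posterior expectation of (b i - c)^2 is the
    posterior risk at the i-th one. Both sides are measures in A; on rectangles
    they factor over the coordinates and differ in the i-th factor only, where
    Bayes' formula in dimension one applies. *)
Lemma joint_bayes i c A : measurable A ->
  (\int[Pi \x P]_(x in [set x | A (obs z n x.1 x.2)]) ((x.1 i - c) ^+ 2)%:E =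
   \int[Pi \x P]_(x in [set x | A (obs z n x.1 x.2)])
      (post_risk (w (tag i)) (a (tag i)) s c (obs z n x.1 x.2 i))%:E)%E.
Proof.
move=> mA; set wi := w (tag i); set ai := a (tag i).
have mc : measurable_fun setT (fun x : coefs R * T => x.1 i).
  exact: (measurableT_comp (measurable_coord i) measurable_fst).
have mobs j : measurable_fun setT (fun x : coefs R * T => obs z n x.1 x.2 j).
  exact: (measurableT_comp (measurable_coord j) (measurable_obs_pair z n)).
have msq : measurable_fun setT (fun b : R => ((b - c) ^+ 2)%:E).
  by apply/measurable_EFinP; apply: measurable_funX; exact: measurable_funB.
have sq0 (b : R) : (0 <= ((b - c) ^+ 2)%:E :> \bar R)%E by rewrite lee_fin sqr_ge0.
have mg : measurable_fun setT (post_risk wi ai s c).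
  exact: (measurable_post_risk c (w01 _) (a0 _) s0).
have g0 x : 0 <= post_risk wi ai s c x.
  exact: (post_risk_ge0 c (w01 _) (a0 _) s0).
have mW1 : measurable_fun setT (fun x : coefs R * T => ((x.1 i - c) ^+ 2)%:E).
  exact: (measurableT_comp msq mc).
have W10 (x : coefs R * T) : (0 <= ((x.1 i - c) ^+ 2)%:E :> \bar R)%E by [].
have mW2 : measurable_fun setT (fun x : coefs R * T =>
    (post_risk wi ai s c (obs z n x.1 x.2 i))%:E).
  by apply/measurable_EFinP; exact: (measurableT_comp mg (mobs i)).
have W20 (x : coefs R * T) : (0 <= (post_risk wi ai s c (obs z n x.1 x.2 i))%:E)%E.
  by rewrite lee_fin.
have [m1 [m1E m1_int]] := exists_weighted_law (Pi \x P)%E mW1 W10 (measurable_obs_pair z n).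
have [m2 [m2E m2_int]] := exists_weighted_law (Pi \x P)%E mW2 W20 (measurable_obs_pair z n).
transitivity (m1 A); first by rewrite m1E.
transitivity (m2 A); last by rewrite m2E.
apply: (@coefs_measure_unique R (tag i).+1) => //.
  rewrite m1E preimage_setT fubini_tonelli1// /fubini_F/=.
  under eq_integral do rewrite probability_integral_cst.
  by apply: le_lt_trans (prior_second_moment i c) _; rewrite ltry.
move=> N B iN mB.
have mrect := measurable_level_rect N mB.
have mind : measurable_fun setT (fun b : coefs R => (\1_(level_rect N B) b)%:E : \bar R).
  by apply/measurable_EFinP; exact: measurable_indic.
have ind0 (b : coefs R) : (0 <= (\1_(level_rect N B) b)%:E :> \bar R)%E by rewrite lee_fin.
have mE (m : {measure set (coefs R) -> \bar R}) :
    m (level_rect N B) = (\int[m]_x (\1_(level_rect N B) x)%:E)%E.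
  by rewrite integral_indic// setIT.
rewrite !mE m1_int// m2_int//.
have iL : i \in levels N by rewrite mem_levels.
pose only (V : \bar R) j := if j == i then V else 1%E.
have prod_only (V : \bar R) : (V = \prod_(j <- levels N) only V j)%E.
  rewrite (bigD1_seq i) ?levels_uniq//= /only eqxx big1 ?mule1//.
  by move=> j /negbTE->.
pose B1 j x : R := \1_(B j) x.
have mB1 j : measurable_fun setT (B1 j) by exact: measurable_indic.
pose U1 j (b : R) := only ((b - c) ^+ 2)%:E j.
pose F2 j (x : R) := (B1 j x * if j == i then post_risk wi ai s c x else 1)%:E.
transitivity (\int[Pi \x P]_x \prod_(j <- levels N)
    (U1 j (x.1 j) * (B1 j (obs z n x.1 x.2 j))%:E))%E.
  apply: eq_integral => x _; rewrite indic_level_rect big_split/=; congr (_ * _)%E.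
  rewrite [LHS]prod_only; apply: eq_bigr => j _.
  by rewrite /U1 /only; case: eqP => // ->.
transitivity (\int[Pi \x P]_x \prod_(j <- levels N)
    (cst 1 (x.1 j) * F2 j (obs z n x.1 x.2 j)))%E; last first.
  apply: eq_integral => x _; rewrite indic_level_rect.
  rewrite [X in _ = (X * _)%E]prod_only.
  rewrite -big_split/=; apply: eq_bigr => j _.
  rewrite mul1e /F2 /only; case: eqP => [->|_]; first by rewrite EFinM muleC.
  by rewrite mulr1 mul1e.
have F20 j x : (0 <= F2 j x)%E by rewrite lee_fin mulr_ge0//; case: ifP.
have mF2 j : measurable_fun setT (F2 j).
  by apply/measurable_EFinP; rewrite /F2; case: (j == i); apply: measurable_funM.
have mU1 j : measurable_fun setT (U1 j) by rewrite /U1 /only; case: (j == i).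
have U10 j b : (0 <= U1 j b)%E by rewrite /U1 /only; case: (j == i).
have mEB1 j : measurable_fun setT (EFin \o B1 j) by exact/measurable_EFinP.
have EB10 j x : (0 <= (EFin \o B1 j) x)%E by rewrite lee_fin.
rewrite (joint_integral_prod (U := U1) (F := fun j => EFin \o B1 j))//.
rewrite (joint_integral_prod (U := fun _ => cst 1%E) (F := F2))//.
apply: eq_bigr => j _; have [->|ji] := eqVneq j i; last first.
  apply: eq_integral => b _; rewrite /U1 /F2 /only (negbTE ji).
  by congr (_ * _)%E; apply: eq_integral => y _; rewrite mulr1.
have mS (u F : R -> \bar R) := @measurable_smooth u F.
rewrite (@integral_spike_slab _ _ _ Pi (fun b : coefs R => b i) wi ai
  (fun b => U1 i b * \int[normal_prob 0 1]_y (EFin \o B1 i) (b + s * y)%R)%E)//; first last.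
- by move=> b; rewrite mule_ge0// integral_ge0.
- exact: mS.
- exact: hPi.2.
- exact: measurable_coord.
- exact: w01.
rewrite (@integral_spike_slab _ _ _ Pi (fun b : coefs R => b i) wi ai
  (fun b => cst 1 b * \int[normal_prob 0 1]_y F2 i (b + s * y)%R)%E)//; first last.
- by move=> b; rewrite mule_ge0// integral_ge0.
- exact: mS.
- exact: hPi.2.
- exact: measurable_coord.
- exact: w01.
have B10 x : 0 <= B1 i x by [].
have := post_risk_bayes c (w01 (tag i)) (a0 (tag i)) s0 (mB1 i) B10.
by rewrite /U1 /F2 /only eqxx.
Qed.
End joint_law.
(** * From the posterior probability to the posterior risk *)

Section level_sums.
Context {R : realType} d (T : measurableType d).

Lemma measurable_level_sum (f : windex -> T -> R) :
  (forall i, measurable_fun setT (f i)) -> (forall i x, 0 <= f i x) ->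
  measurable_fun setT
    (fun x => (\sum_(0 <= j <oo) (\sum_(k < 2 ^ j) f (widx k) x)%:E)%E).
Proof.
move=> mf f0; apply: ge0_emeasurable_sum.
  by move=> j x _ _; rewrite lee_fin sumr_ge0.
by move=> j _; apply/measurable_EFinP; exact: measurable_sum.
Qed.

Lemma integral_level_sum (mu : {measure set T -> \bar R}) (D : set T)
    (f : windex -> T -> R) :
  measurable D ->
  (forall i, measurable_fun setT (f i)) -> (forall i x, 0 <= f i x) ->
  (\int[mu]_(x in D) \sum_(0 <= j <oo) (\sum_(k < 2 ^ j) f (widx k) x)%:E =
   \sum_(0 <= j <oo) \sum_(k < 2 ^ j) \int[mu]_(x in D) (f (widx k) x)%:E)%E.
Proof.
move=> mD mf f0; rewrite integral_nneseries//.
- apply: eq_eseriesr => j _; under eq_integral do rewrite -sumEFin.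
  rewrite ge0_integral_sum// => k.
    by apply/measurable_EFinP; exact: measurable_funTS.
  by move=> x _; rewrite lee_fin.
- move=> j; apply: measurable_funTS; apply/measurable_EFinP.
  exact: measurable_sum.
- by move=> j x _; rewrite lee_fin sumr_ge0.
Qed.

End level_sums.

Lemma sq_distC (R : realType) (b b' : coefs R) : sq_dist b b' = sq_dist b' b.
Proof.
apply: eq_eseriesr => j _; congr EFin; apply: eq_bigr => k _.
by rewrite -sqrrN opprB.
Qed.

Lemma measurable_sq_dist (R : realType) (b0 : coefs R) :
  measurable_fun setT (fun b : coefs R => sq_dist b b0).
Proof.
apply: (measurable_level_sum (f := fun i (b : coefs R) => (b i - b0 i) ^+ 2)).
  move=> i; apply: measurable_funX; apply: measurable_funB => //.
  exact: measurable_coord.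
by move=> i x; exact: sqr_ge0.
Qed.

Lemma sq_dist_ge0 (R : realType) (b b' : coefs R) : (0 <= sq_dist b b')%E.
Proof.
by apply: nneseries_ge0 => j _ _; rewrite lee_fin sumr_ge0// => k _; exact: sqr_ge0.
Qed.

Section posterior_bound.
Context {R : realType} d (T : measurableType d) (P : probability T R).
Variables (z : windex -> {RV P >-> R}) (hz : std_gaussian_noise z).
Variables (n : nat) (n0 : (0 < n)%N).
Variables (w a : nat -> R) (Pi : probability (coefs R) R).
Hypotheses (w01 : forall j, 0 <= w j <= 1) (a0 : forall j, 0 < a j).
Hypothesis hPi : spike_slab_prior w a Pi.
Variable (b0 : coefs R).
Hypothesis prior_fin : (\int[Pi]_b sq_dist b b0 < +oo)%E.
Variable K : R.-pker (coefs R) ~> (coefs R).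
Hypothesis hK : is_posterior z n Pi K.

Let s : R := (Num.sqrt n%:R)^-1.
Let s0 : 0 < s. Proof. by rewrite invr_gt0 sqrtr_gt0 ltr0n. Qed.

Let risk i (x : R) : R := post_risk (w (tag i)) (a (tag i)) s (b0 i) x.

Let risk_ge0 i x : 0 <= risk i x.
Proof. exact: (post_risk_ge0 (b0 i) (w01 _) (a0 _) s0). Qed.

Let measurable_risk i : measurable_fun setT (risk i).
Proof. exact: (measurable_post_risk (b0 i) (w01 _) (a0 _) s0). Qed.

Let total_risk (x : coefs R) : \bar R :=
  (\sum_(0 <= j <oo) (\sum_(k < 2 ^ j) risk (widx k) (x (widx k)))%:E)%E.

Let measurable_total_risk : measurable_fun setT total_risk.
Proof.
apply: (measurable_level_sum (f := fun i (x : coefs R) => risk i (x i))) => // i.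
by apply: (measurableT_comp (measurable_risk i)); exact: measurable_coord.
Qed.

Let total_risk_ge0 x : (0 <= total_risk x)%E.
Proof. by apply: nneseries_ge0 => j _ _; rewrite lee_fin sumr_ge0. Qed.

Let joint_total A : measurable A ->
  (\int[Pi \x P]_(x in [set x | A (obs z n x.1 x.2)]) sq_dist x.1 b0 =
   \int[Pi \x P]_(x in [set x | A (obs z n x.1 x.2)]) total_risk (obs z n x.1 x.2))%E.
Proof.
move=> mA.
have mobs := measurable_obs_pair z n.
have mD : measurable [set x : coefs R * T | A (obs z n x.1 x.2)].
  by have := mobs measurableT _ mA; rewrite setTI.
rewrite (integral_level_sum (Pi \x P)%E
  (f := fun i (x : coefs R * T) => (x.1 i - b0 i) ^+ 2) mD); last 2 first.
- move=> i; apply: measurable_funX; apply: measurable_funB => //.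
  exact: (measurableT_comp (measurable_coord i) measurable_fst).
- by move=> i x; exact: sqr_ge0.
rewrite (integral_level_sum (Pi \x P)%E
  (f := fun i (x : coefs R * T) => risk i (obs z n x.1 x.2 i)) mD)//; last first.
  move=> i; apply: (measurableT_comp (measurable_risk i)).
  exact: (measurableT_comp (measurable_coord i) mobs).
by apply: eq_eseriesr => j _; apply: eq_bigr => k _; exact: joint_bayes.
Qed.

(* The observations at which the bound delta * K x D <= total_risk x + eta of the
   posterior probability of D by the posterior risk fails or is attained. The
   slack eta > 0 turns the integrated inequality into an upper bound on the
   measure of this set. *)
Let bad (delta eta : R) : set (coefs R) :=
  [set x | (total_risk x + eta%:E <=
            delta%:E * K x [set b | (delta%:E < sq_dist b b0)%E])%E].

Let mfar (delta : R) : measurable [set b : coefs R | (delta%:E < sq_dist b b0)%E].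
Proof.
rewrite -[X in measurable X]setTI.
by apply: emeasurable_fun_o_infty => //; exact: measurable_sq_dist.
Qed.

Let measurable_bad delta eta : measurable (bad delta eta).
Proof.
rewrite -[X in measurable X]setTI; apply: emeasurable_fun_le => //.
  exact: emeasurable_funD.
apply: emeasurable_funM => //; exact: measurable_kernel.
Qed.

Let bad_null delta eta : 0 < delta -> 0 < eta ->
  (Pi \x P)%E [set x | bad delta eta (obs z n x.1 x.2)] = 0%E.
Proof.
move=> delta0 eta0.
set D := [set b : coefs R | (delta%:E < sq_dist b b0)%E].
set A := bad delta eta; have mA : measurable A by exact: measurable_bad.
have mobs := measurable_obs_pair z n.
have mobsA : measurable [set x : coefs R * T | A (obs z n x.1 x.2)].
  by have := mobs measurableT _ mA; rewrite setTI.
set B := [set x : coefs R * T | A (obs z n x.1 x.2)].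
have mfst : measurable [set x : coefs R * T | D x.1].
  by have := @measurable_fst _ _ (coefs R) T measurableT _ (mfar delta); rewrite setTI.
have mKD : measurable_fun setT (fun x : coefs R * T => K (obs z n x.1 x.2) D).
  exact: (measurableT_comp (measurable_kernel K D (mfar delta)) mobs).
have mtot : measurable_fun setT (fun x : coefs R * T => total_risk (obs z n x.1 x.2)).
  exact: measurableT_comp.
have msq : measurable_fun setT (fun x : coefs R * T => sq_dist x.1 b0).
  exact: (measurableT_comp (measurable_sq_dist b0) measurable_fst).
have up : (\int[Pi \x P]_(x in B) (delta%:E * K (obs z n x.1 x.2) D) <=
           \int[Pi \x P]_(x in B) total_risk (obs z n x.1 x.2))%E.
  rewrite ge0_integralZl//; last 2 first.
  - exact: measurable_funTS.
  - by rewrite lee_fin ltW.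
  rewrite hK//; last exact: mfar.
  rewrite -joint_total//.
  have mBD : measurable (B `&` [set x | D x.1]) by exact: measurableI.
  apply: (@le_trans _ _ (\int[Pi \x P]_(x in B `&` [set x | D x.1]) sq_dist x.1 b0)%E).
    rewrite -integral_cst//; apply: ge0_le_integral => //.
    - by move=> x _; rewrite lee_fin ltW.
    - exact: measurable_funTS.
    - by move=> x [_] /= /ltW.
  by apply: ge0_subset_integral => //; [exact: measurable_funTS|move=> x _; exact: sq_dist_ge0].
have lo : (\int[Pi \x P]_(x in B) total_risk (obs z n x.1 x.2) +
           eta%:E * (Pi \x P) B <=
           \int[Pi \x P]_(x in B) (delta%:E * K (obs z n x.1 x.2) D))%E.
  rewrite -integral_cst// -ge0_integralD//; last 2 first.
  - exact: measurable_funTS.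
  - by move=> x _; rewrite lee_fin ltW.
  apply: ge0_le_integral => //.
  - by move=> x _; rewrite adde_ge0// lee_fin ltW.
  - by apply: emeasurable_funD => //; exact: measurable_funTS.
  - by apply: measurable_funTS; exact: emeasurable_funM.
have fin : (\int[Pi \x P]_(x in B) (delta%:E * K (obs z n x.1 x.2) D) \is a fin_num)%E.
  rewrite ge0_fin_numE; last by apply: integral_ge0 => x _; rewrite mule_ge0// lee_fin ltW.
  apply: (@le_lt_trans _ _ (\int[Pi \x P]_(x in B) delta%:E)%E).
    apply: ge0_le_integral => //.
    - by move=> x _; rewrite mule_ge0// lee_fin ltW.
    - by apply: measurable_funTS; exact: emeasurable_funM.
    - move=> x _; rewrite -[leRHS]mule1 lee_wpmul2l ?lee_fin ?(ltW delta0)//.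
      by rewrite -(@prob_kernel _ _ _ _ _ K (obs z n x.1 x.2)); apply: le_measure; rewrite ?inE//; exact: mfar.
  have le1 : ((Pi \x P) B <= 1)%E.
    have <- : ((Pi \x P) setT = 1)%E.
      transitivity (Pi setT * P setT)%E.
        by rewrite -setXTT; exact: product_measure1E.
      by rewrite !probability_setT mule1.
    by apply: le_measure; rewrite ?inE.
  rewrite integral_cst//; apply: (@le_lt_trans _ _ (delta%:E * 1)%E).
    by apply: lee_wpmul2l => //; rewrite lee_fin ltW.
  by rewrite mule1 ltry.
have gfin : (\int[Pi \x P]_(x in B) total_risk (obs z n x.1 x.2) \is a fin_num)%E.
  rewrite ge0_fin_numE; last exact: integral_ge0.
  rewrite ge0_fin_numE in fin; last by apply: integral_ge0 => x _; rewrite mule_ge0// lee_fin ltW.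
  apply: le_lt_trans fin; apply: le_trans lo; rewrite leeDl//.
  by rewrite mule_ge0// lee_fin ltW.
have := le_trans lo up; rewrite -[leRHS]adde0 leeD2lE//.
rewrite pmule_rle0 ?lte_fin// => mB0; apply/eqP; rewrite eq_le mB0 andTb.
exact: measure_ge0.
Qed.

Let bad_null_obs delta eta : 0 < delta -> 0 < eta ->
  P (obs z n b0 @^-1` bad delta eta) = 0%E.
Proof.
move=> delta0 eta0; have := bad_null delta0 eta0.
set A := bad delta eta; have mA : measurable A by exact: measurable_bad.
have mobs := measurable_obs_pair z n.
have mB : measurable [set x : coefs R * T | A (obs z n x.1 x.2)].
  by have := mobs measurableT _ mA; rewrite setTI.
rewrite /product_measure1/= => PA0.
have mPA : measurable_fun setT (fun b : coefs R => P (obs z n b @^-1` A)).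
  have := measurable_fun_xsection P mB.
  by congr (measurable_fun _ _); apply/funext => b; rewrite /= xsectionE.
have aePA : {ae Pi, forall b, P (obs z n b @^-1` A) = 0%E}.
  have /(ae_eq_integral_abs Pi measurableT mPA) :
      (\int[Pi]_b `|P (obs z n b @^-1` A)| = 0)%E.
    rewrite -PA0; apply: eq_integral => b _.
    by rewrite gee0_abs// /= xsectionE.
  by apply: filterS => b; exact.
have aefin : {ae Pi, forall b, sq_dist b b0 \is a fin_num}.
  have intg : Pi.-integrable setT (fun b => sq_dist b b0).
    apply/integrableP; split; first exact: measurable_sq_dist.
    by under eq_integral do rewrite gee0_abs ?sq_dist_ge0//.
  have := integrable_ae measurableT intg.
  by apply: filterS => b; exact.
(* a parameter at which the exceptional set is null, at finite distance of b0 *)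
have [b [bA bfin]] : exists b : coefs R,
    P (obs z n b @^-1` A) = 0%E /\ sq_dist b b0 \is a fin_num.
  have : {ae Pi, forall b, P (obs z n b @^-1` A) = 0%E /\ sq_dist b b0 \is a fin_num}.
    by apply: filterS2 aePA aefin.
  move=> [N [mN N0 sub]]; apply: contrapT => nex.
  have NT : N = setT.
    by apply/seteqP; split => // b _; apply: sub => /= h; apply: nex; exists b.
  by move: N0; rewrite NT probability_setT => /eqP; rewrite onee_eq0.
apply: (obs_null_shift hz n0 (b := b)) => //.
by rewrite sq_distC -ge0_fin_numE// sq_dist_ge0.
Qed.

(** Markov's inequality is used twice: for the posterior, to pass from the tail of
    sq_dist to the posterior risk, and for the data at b0, to pass from the tail
    of the posterior risk to its expectation. *)
Lemma posterior_tail_le (delta e : R) : 0 < delta -> 0 < e ->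
  (P [set omega | (e%:E <
       K (obs z n b0 omega) [set b | (delta%:E < sq_dist b b0)%E])%E] <=
   (2 / (e * delta))%:E *
     \sum_(0 <= j <oo) \sum_(k < 2 ^ j) \int[normal_prob 0 1]_y
        (post_risk (w j) (a j) s (b0 (widx k)) (b0 (widx k) + s * y))%:E)%E.
Proof.
move=> delta0 e0; set D := [set b : coefs R | _].
have ed0 : 0 < e * delta by rewrite mulr_gt0.
have eta0 : 0 < e * delta / 2 by rewrite divr_gt0.
have mobs := measurable_obs z n b0.
have mtot : measurable_fun setT (fun omega => total_risk (obs z n b0 omega)).
  exact: measurableT_comp.
have mA := measurable_bad delta (e * delta / 2).
have mobsA := measurable_obs_preimage z n b0 mA.
set A := bad delta _ in mA mobsA.
pose C := [set omega | ((e * delta / 2)%:E <= total_risk (obs z n b0 omega))%E].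
have mC : measurable C.
  by rewrite -[C]setTI; apply: emeasurable_fun_c_infty.
have mKD : measurable_fun setT (fun omega => K (obs z n b0 omega) D).
  exact: (measurableT_comp (measurable_kernel K D (mfar delta)) mobs).
apply: (@le_trans _ _ (P (obs z n b0 @^-1` A `|` C))).
  apply: le_measure; rewrite ?inE.
  - by rewrite -[X in measurable X]setTI; apply: emeasurable_fun_o_infty.
  - exact: measurableU.
  - move=> omega /= eK.
    have [Cw|/negP nCw] := boolP ((e * delta / 2)%:E <= total_risk (obs z n b0 omega))%E.
      by right.
    left; rewrite /A /bad /=.
    move/negP: nCw; rewrite -ltNge => tot.
    apply: (@le_trans _ _ (e * delta)%:E).
      by rewrite [in leRHS](splitr (e * delta)) EFinD leeD2r// ltW.
    by rewrite mulrC EFinM lee_wpmul2l ?lee_fin ?(ltW delta0)// ltW.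
apply: (@le_trans _ _ (P (obs z n b0 @^-1` A) + P C)%E); first exact: measureU2.
have -> : P (obs z n b0 @^-1` A) = 0%E by exact: bad_null_obs.
rewrite add0e.
have -> : (\sum_(0 <= j <oo) \sum_(k < 2 ^ j) \int[normal_prob 0 1]_y
    (post_risk (w j) (a j) s (b0 (widx k)) (b0 (widx k) + s * y))%:E =
    \int[P]_omega total_risk (obs z n b0 omega))%E.
  rewrite (integral_level_sum P (f := fun i omega => risk i (obs z n b0 omega i)) measurableT)//.
    apply: eq_eseriesr => j _; apply: eq_bigr => k _.
    transitivity (\int[P]_omega (risk (widx k) (b0 (widx k) + s * z (widx k) omega))%:E)%E.
      rewrite (@integral_has_law _ _ _ P (z (widx k)) (normal_prob 0 1)
        (fun y => (risk (widx k) (b0 (widx k) + s * y))%:E))//.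
      - exact: hz.2.
      - apply/measurable_EFinP; apply: (measurableT_comp (measurable_risk _)).
        exact: measurable_affine.
      - by move=> y; rewrite lee_fin.
    by apply: eq_integral => omega _; rewrite /obs [s * _]mulrC.
  move=> i; apply: (measurableT_comp (measurable_risk i)).
  exact: (measurableT_comp (measurable_coord i) mobs).
have := le_integral_abse P measurableT mtot eta0.
under [X in (_ <= X -> _)%E]eq_integral do rewrite gee0_abs//.
have -> : setT `&` [set x | ((e * delta / 2)%:E <= `|total_risk (obs z n b0 x)|)%E] = C.
  by rewrite setTI; apply/seteqP; split => x /=; rewrite gee0_abs.
have k0 : (0 <= (2 / (e * delta))%:E)%E by rewrite lee_fin divr_ge0// ltW.
move=> /(lee_wpmul2l k0); rewrite muleA -EFinM.
by rewrite (_ : _ * _ = 1) ?mul1e//; field; rewrite !gt_eqF.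
Qed.

End posterior_bound.
(** * Besov balls level by level *)

Lemma powRD_gt0 (R : realType) (x u v : R) : 0 < x ->
  x `^ u * x `^ v = x `^ (u + v).
Proof. by move=> x0; rewrite powRD//; apply/implyP => _; exact: lt0r_neq0. Qed.

Lemma natr_2expn (R : realType) j : ((2 ^ j)%N%:R : R) = 2 `^ j%:R.
Proof. by rewrite natrX powR_mulrn. Qed.

Section besov_levels.
Context {R : realType}.

(** For r >= 2, among vectors with a given l_r norm, those with constant modulus A
    are extremal for the l_2 norm. Up to the factor 2 this follows from
    u^2 <= 1 + u^r with u = |x k| / A. *)
Lemma sum_sqr_le_flat m (x : 'I_m -> R) (r A : R) : 2 <= r -> 0 < A ->
  \sum_(k < m) `|x k| `^ r <= m%:R * A `^ r ->
  \sum_(k < m) (x k) ^+ 2 <= 2 * m%:R * A ^+ 2.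
Proof.
move=> r2 A0 xA.
have Ar0 : 0 < A `^ r by exact: powR_gt0.
have key k : (x k) ^+ 2 <= A ^+ 2 + A ^+ 2 / A `^ r * `|x k| `^ r.
  rewrite -[X in X <= _]real_normK ?num_real//.
  have [xk|Ax] := leP `|x k| A.
    apply: (@le_trans _ _ (A ^+ 2)); first by rewrite ler_pXn2r ?nnegrE// ltW.
    by rewrite lerDl mulr_ge0 ?powR_ge0// divr_ge0 ?sqr_ge0// ltW.
  have u1 : 1 <= `|x k| / A by rewrite ler_pdivlMr// mul1r ltW.
  have -> : A ^+ 2 / A `^ r * `|x k| `^ r = A ^+ 2 * (`|x k| / A) `^ r.
    have Ai : (A^-1) `^ r = (A `^ r)^-1.
      by rewrite -[A^-1]powR_inv1 ?(ltW A0)// -powRrM mulN1r powRN.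
    by rewrite powRM ?invr_ge0 ?(ltW A0)// Ai; ring.
  have : (`|x k| / A) `^ 2%:R <= (`|x k| / A) `^ r by exact: ler_powR.
  rewrite powR_mulrn ?(le_trans ler01)// expr_div_n => h.
  have := ler_wpM2l (sqr_ge0 A) h; rewrite mulrCA mulfV ?mulr1 ?expf_neq0 ?gt_eqF//.
  by move=> h2; apply: le_trans h2 _; rewrite lerDr sqr_ge0.
apply: le_trans (ler_sum _ (fun k _ => key k)) _.
rewrite big_split/= sumr_const card_ord -mulr_sumr -[_ *+ m]mulr_natl.
have c0 : 0 <= A ^+ 2 / A `^ r by rewrite divr_ge0 ?sqr_ge0// ltW.
have := ler_wpM2l c0 xA; rewrite mulrCA divfK ?gt_eqF//; lra.
Qed.

(** For r <= 2, among vectors with a given l_r norm, those with a single nonzero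
    entry D are extremal for the l_2 norm. *)
Lemma sum_sqr_le_concentrated m (x : 'I_m -> R) (r D : R) : 0 < r <= 2 -> 0 < D ->
  \sum_(k < m) `|x k| `^ r <= D `^ r -> \sum_(k < m) (x k) ^+ 2 <= D ^+ 2.
Proof.
move=> /andP[r0 r2] D0 xD.
have xk k : `|x k| <= D.
  have xkr : `|x k| `^ r <= D `^ r.
    apply: le_trans xD; rewrite (bigD1 k)//= lerDl.
    by apply: sumr_ge0 => i _; exact: powR_ge0.
  rewrite leNgt; apply/negP => Dx; move: xkr; rewrite leNgt => /negP; apply.
  by apply: gt0_ltr_powR; rewrite ?nnegrE//; exact: ltW.
have key k : (x k) ^+ 2 <= D `^ (2 - r) * `|x k| `^ r.
  rewrite -[X in X <= _]real_normK ?num_real//.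
  have [->|x0] := eqVneq (x k) 0; first by rewrite normr0 expr0n mulr_ge0 ?powR_ge0.
  have -> : `|x k| ^+ 2 = `|x k| `^ (2 - r) * `|x k| `^ r.
    by rewrite powRD_gt0 ?normr_gt0// subrK powR_mulrn.
  rewrite ler_wpM2r ?powR_ge0//; apply: ge0_ler_powR; rewrite ?nnegrE ?subr_ge0//.
  exact: ltW.
apply: le_trans (ler_sum _ (fun k _ => key k)) _; rewrite -mulr_sumr.
apply: le_trans (ler_wpM2l (powR_ge0 _ _) xD) _.
by rewrite powRD_gt0// subrK powR_mulrn// ltW.
Qed.

(** A single term of the defining series, or supremum, is bounded by the norm. *)
Lemma besov_ball_level (s : R) (p q : \bar R) (a00 B : R) (b : coefs R) j :
  (1%:E <= q)%E -> besov_ball s p q a00 B b ->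
  2 `^ (j%:R * (s + 2^-1 - rinv p)) * level_norm p b j <= B.
Proof.
move=> q1; rewrite /besov_ball/= /besov_norm => bB.
have ln0 i : 0 <= level_norm p b i.
  rewrite /level_norm /lp_norm; case: p {bB} => [r||]; first exact: powR_ge0.
    by apply: bigmax_ge_id.
  by apply: bigmax_ge_id.
have {}bB : (besov_seminorm s p q b <= B%:E)%E.
  by apply: le_trans (ltW bB); rewrite leeDr.
set x := (X in X <= _).
have x0 : 0 <= x by rewrite mulr_ge0 ?powR_ge0.
rewrite -lee_fin; apply: le_trans bB.
case: q q1 => [r r1|_|//]; last by apply: ereal_sup_ubound; exists j.
have r0 : 0 < r by move: r1; rewrite lee_fin; exact: lt_le_trans.
rewrite /besov_seminorm.
have xr : ((x `^ r)%:E <= \sum_(0 <= j <oo)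
    (2 `^ (j%:R * (s + 2^-1 - rinv p) * r) * level_norm p b j `^ r)%:E)%E.
  apply: le_trans (nneseries_lim_ge j.+1 _) => [|i _ _]; last first.
    by rewrite lee_fin mulr_ge0 ?powR_ge0.
  rewrite big_nat_recr//= -[leLHS]add0e; apply: leeD.
    by apply: sume_ge0 => i _; rewrite lee_fin mulr_ge0 ?powR_ge0.
  by rewrite lee_fin powRM ?powR_ge0// -powRrM.
have -> : x%:E = ((x `^ r)%:E `^ r^-1)%E.
  by rewrite poweR_EFin -powRrM divff ?gt_eqF// powRr1.
apply: gt0_ler_poweR => //; rewrite ?invr_ge0 ?(ltW r0)//.
- by rewrite in_itv/= lee_fin powR_ge0/= leey.
- rewrite in_itv/= leey andbT; apply: le_trans xr.
  by rewrite lee_fin powR_ge0.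
Qed.

Lemma rinv_EFin (r : R) : 1 <= r -> rinv r%:E = r^-1.
Proof.
move=> r1; rewrite /rinv inver gt_eqF//; exact: lt_le_trans r1.
Qed.

Lemma rinv_pinfty : rinv (+oo%E : \bar R) = 0.
Proof. by rewrite /rinv invey. Qed.

(** Besov balls are included in balls of B^{s'}_{2,oo} with 2 s' = alpha - 1: for
    p >= 2, s' = s, and for p < 2 the embedding loses 1/p - 1/2 derivatives. *)
Lemma besov_ball_l2 (s : R) (p q : \bar R) (a00 B : R) (b : coefs R) j :
  (1%:E <= p)%E -> (1%:E <= q)%E -> 0 < B -> besov_ball s p q a00 B b ->
  \sum_(k < 2 ^ j) b (widx k) ^+ 2 <=
    2 * B ^+ 2 * (2 `^ j%:R) `^ (- (alpha s p - 1)).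
Proof.
move=> p1 q1 B0 /(besov_ball_level j q1).
set e := s + 2^-1 - rinv p; set L := level_norm p b j => LB.
pose D := B * 2 `^ (- (j%:R * e)).
have D0 : 0 < D by rewrite mulr_gt0 ?powR_gt0.
have LD : L <= D.
  by rewrite /D powRN ler_pdivlMr ?powR_gt0// mulrC.
pose A := D * 2 `^ (- (j%:R * rinv p)).
have A0 : 0 < A by rewrite mulr_gt0 ?powR_gt0.
have D2 : D ^+ 2 = B ^+ 2 * 2 `^ (- (j%:R * (2 * e))).
  rewrite /D exprMn -(powR_mulrn 2 (powR_ge0 _ _)) -powRrM.
  by congr (_ * _ `^ _); ring.
have flat : 2 * (2 ^ j)%N%:R * A ^+ 2 =
    2 * B ^+ 2 * (2 `^ j%:R) `^ (- (2 * s + 1 - 1)).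
  rewrite natr_2expn /A exprMn D2 -(powR_mulrn 2 (powR_ge0 _ _)) -!powRrM.
  transitivity (2 * B ^+ 2 * (2 `^ j%:R * (2 `^ (- (j%:R * (2 * e))) *
      2 `^ (- (j%:R * rinv p) * 2%:R)))); first by ring.
  by rewrite !powRD_gt0//; congr (_ * _ `^ _); rewrite /e; field.
have [p2|p2] := leP 2%:E p; last first.
  case: p p1 p2 @e @L LB D D0 LD @A A0 D2 flat => [r|//|//].
  rewrite lee_fin lte_fin => r1 r2 e L LB D D0 LD _ _ D2 _.
  have r0 : 0 < r by exact: lt_le_trans r1.
  apply: (@le_trans _ _ (D ^+ 2)).
    apply: (@sum_sqr_le_concentrated _ (fun k => b (widx k)) r) => //.
      by rewrite r0 ltW.
    have := ge0_ler_powR (ltW r0) _ _ LD; rewrite !nnegrE (ltW D0) /L powR_ge0.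
    by rewrite /level_norm /lp_norm -powRrM mulVf ?gt_eqF// powRr1 ?sumr_ge0//; apply.
  rewrite D2 /alpha lee_fin (leNgt 2 r) r2/= -powRrM.
  rewrite (_ : - (j%:R * (2 * e)) = j%:R * - (2 * s + 2 - 2 * rinv r%:E - 1)); last first.
    by rewrite /e; field.
  rewrite -mulrA.
  by rewrite ler_peMl ?ler1n// mulr_ge0 ?sqr_ge0 ?powR_ge0.
rewrite /alpha p2 -flat.
case: p p1 p2 @e @L LB D D0 LD @A A0 D2 flat => [r|_ _|//].
  rewrite !lee_fin => r1 r2 e L LB D D0 LD A A0 D2 _.
  have r0 : 0 < r by exact: lt_le_trans r1.
  apply: (@sum_sqr_le_flat _ (fun k => b (widx k)) r) => //.
  have := ge0_ler_powR (ltW r0) _ _ LD; rewrite !nnegrE (ltW D0) /L powR_ge0.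
  rewrite /level_norm /lp_norm -powRrM mulVf ?gt_eqF// powRr1 ?sumr_ge0// => /(_ isT isT).
  move/le_trans; apply.
  rewrite /A powRM ?powR_ge0 ?(ltW D0)// -powRrM natr_2expn rinv_EFin//.
  rewrite mulrCA powRD_gt0// (_ : _ + _ = 0) ?powRr0 ?mulr1//.
  by field; rewrite gt_eqF.
move=> e L LB D D0 LD A A0 D2 _.
have AD : A = D by rewrite /A rinv_pinfty mulr0 oppr0 powRr0 mulr1.
apply: (@le_trans _ _ (\sum_(k < 2 ^ j) A ^+ 2)).
  apply: ler_sum => k _; rewrite -[X in X <= _]real_normK ?num_real//.
  rewrite ler_pXn2r ?nnegrE ?(ltW A0)// AD; apply: le_trans LD.
  exact: (le_bigmax _ (fun k : 'I_(2 ^ j) => `|b (widx k)|)).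
rewrite sumr_const card_ord -[_ *+ _]mulr_natl -mulrA ler_peMl ?ler1n//.
by rewrite mulr_ge0 ?sqr_ge0.
Qed.

Lemma alpha_gt1 (s : R) (p : \bar R) : (1%:E <= p)%E ->
  Num.max 0 (rinv p - 2^-1) < s -> 1 < alpha s p.
Proof.
by move=> p1; rewrite gt_max /alpha => /andP[s0 sp]; case: ifP => _; lra.
Qed.

Lemma rate2E (s : R) (p : \bar R) n :
  rate2 s p n = ln n%:R ^+ 2 * n%:R `^ (- ((alpha s p - 1) / alpha s p)).
Proof.
rewrite /rate2 /alpha; case: ifP => _; first by rewrite addrK.
have -> : 2 * s + 2 - 2 * rinv p - 1 = 2 * s + 1 - 2 * rinv p by ring.
by [].
Qed.

End besov_levels.
(** * Summation over the resolution levels *)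

Section resolution_profile.
Context {R : realType}.

(** Relative size of the risk of level j as a function of t = 2^j / n^(1/alpha).
    At t = 1 prior and noise variance are of the same order; below, the risk is
    proportional to the number 2^j of coefficients, and above it decays like the
    squared norm of the coefficients of the level. *)
Definition profile (c t : R) : R := if t <= 1 then t else t `^ (- c).

(** Geometric sums on both sides of t = 1. Counted from the critical level, the
    terms t <= 1 add up to at most 2, and the others to at most the sum of the
    powers of r = 2^(-c); the induction carries the terms that are still to come. *)
Lemma sum_profile_le (c N : R) m : 0 < c -> 0 < N ->
  \sum_(0 <= j < m) profile c (2 `^ j%:R / N) <= 2 + (1 - 2 `^ (- c))^-1.
Proof.
move=> c0 N0; pose t j : R := 2 `^ j%:R / N.
have t0 j : 0 < t j by rewrite divr_gt0 ?powR_gt0.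
have tS j : t j.+1 = 2 * t j.
  by rewrite /t -[j.+1%:R]natr1 -powRD_gt0// powRr1//; ring.
pose r : R := 2 `^ (- c).
have r0 : 0 < r by exact: powR_gt0.
have r1 : r < 1.
  rewrite /r powRN invf_lt1 ?powR_gt0//.
  have := @gt0_ltr_powR R c c0 1 2; rewrite !nnegrE powR1 => -> //.
  by rewrite ltr1n.
pose D := (1 - r)^-1.
have D0 : 0 < D by rewrite invr_gt0 subr_gt0.
have DE : D * (1 - r) = 1 by rewrite mulVf// gt_eqF// subr_gt0.
pose u j := Num.min 1 (t j `^ (- c)).
have tcS j : t j.+1 `^ (- c) = r * t j `^ (- c).
  by rewrite tS powRM// ltW.
have mono (x y : R) : 0 <= x -> x <= y -> x `^ c <= y `^ c.
  move=> x0 xy; apply: ge0_ler_powR; rewrite ?nnegrE ?(ltW c0)//.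
  exact: le_trans xy.
have u1 j : u j <= 1 by rewrite ge_min lexx.
suff [H1 H2] : \sum_(0 <= j < m) (if t j <= 1 then t j else 0) <= Num.min 2 (t m) /\
    \sum_(0 <= j < m) (if t j <= 1 then 0 else t j `^ (- c)) <= D * (1 - u m).
  rewrite (eq_bigr (fun j => (if t j <= 1 then t j else 0) +
      (if t j <= 1 then 0 else t j `^ (- c)))); last first.
    by move=> j _; rewrite /profile -/(t j); case: ifP => _; rewrite ?addr0 ?add0r.
  rewrite big_split/= lerD//; first by apply: le_trans H1 _; rewrite ge_min lexx.
  apply: le_trans H2 _; rewrite -/D ler_piMr ?(ltW D0)// lerBlDr lerDl.
  by rewrite le_min ler01 powR_ge0.
elim: m => [|m [ih1 ih2]].
  rewrite !big_nil le_min ler0n ltW//=; split => //.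
  by rewrite mulr_ge0 ?(ltW D0)// subr_ge0.
rewrite !big_nat_recr//=; have [tm1|tm1] := leP (t m) 1.
  rewrite addr0; split.
    move: ih1; rewrite !le_min tS => /andP[_ ih1]; apply/andP; split; lra.
  apply: le_trans ih2 _; have -> : u m = 1.
    apply/min_idPl; rewrite powRN invf_ge1 ?powR_gt0//.
    by have := mono _ _ (ltW (t0 m)) tm1; rewrite powR1.
  by rewrite subrr mulr0 mulr_ge0 ?(ltW D0)// subr_ge0.
rewrite addr0; split.
  move: ih1; rewrite !le_min tS => /andP[-> ih1] /=; have := t0 m; lra.
have tmc : t m `^ (- c) <= 1.
  rewrite powRN invf_le1 ?powR_gt0//.
  by have := mono _ _ ler01 (ltW tm1); rewrite powR1.
have um : u m = t m `^ (- c) by exact/min_idPr.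
have umS : u m.+1 = r * t m `^ (- c).
  rewrite /u tcS; apply/min_idPr; apply: le_trans tmc.
  by rewrite ler_piMl ?powR_ge0// ltW.
move: ih2; rewrite umS um; move: (t m `^ (- c)) => v ih2.
have : D * (1 - r * v) = D * (1 - v) + D * (1 - r) * v by ring.
by rewrite DE; lra.
Qed.

End resolution_profile.

Section level_risk.
Context {R : realType}.
Variables (al g ca Ca cw Cb : R).
Hypotheses (al1 : 1 < al) (g0 : 0 <= g) (ca0 : 0 < ca) (Ca0 : 0 < Ca).
Hypotheses (cw0 : 0 < cw) (Cb0 : 0 < Cb).
(* X = 2 ^ j, m = n, a2 and v: slab variance and weight on level j, S: squared
   norm of the true coefficients of level j. Then Y = 2 ^ (alpha j), and N is the
   critical scale. *)
Variables (X m a2 v S : R).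
Hypotheses (X1 : 1 <= X) (m1 : 1 <= m) (Sge0 : 0 <= S).
Hypothesis a2P : ca * X `^ (- al) <= a2 <= Ca * X `^ (- al).
Hypothesis vP : cw * X `^ (- g) <= v.
Hypothesis SP : S <= Cb * X `^ (- (al - 1)).

Let X0 : 0 < X. Proof. exact: lt_le_trans X1. Qed.
Let m0 : 0 < m. Proof. exact: lt_le_trans m1. Qed.
Let Y := X `^ al.
Let Y1 : 1 <= Y.
Proof. by apply: le_trans X1 _; apply: le1r_powR => //; exact: ltW. Qed.
Let Y0 : 0 < Y. Proof. exact: lt_le_trans Y1. Qed.
Let XNal : X `^ (- al) = Y^-1. Proof. by rewrite powRN. Qed.
Let XNal1 : X `^ (- (al - 1)) = X / Y.
Proof. by rewrite opprB addrC -powRD_gt0// XNal powRr1 ?(ltW X0)// mulrC. Qed.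
Let a20 : 0 < a2.
Proof. by case/andP: a2P => h _; apply: lt_le_trans h; rewrite mulr_gt0 ?powR_gt0. Qed.
Let v0 : 0 < v.
Proof. by apply: lt_le_trans vP; rewrite mulr_gt0 ?powR_gt0. Qed.
Let N := m `^ al^-1.
Let N0 : 0 < N. Proof. exact: powR_gt0. Qed.
Let rho := m `^ (- ((al - 1) / al)).
Let rhoE : rho = N / m.
Proof.
rewrite /rho /N -[m^-1]powR_inv1 ?(ltW m0)// powRD_gt0//; congr (_ `^ _).
by field; rewrite gt_eqF// (lt_trans _ al1).
Qed.

Let scaleE : (X / N <= 1) = (Y <= m).
Proof.
have al0 : 0 < al by exact: lt_trans al1.
have NE : N `^ al = m by rewrite /N -powRrM mulVf ?gt_eqF// powRr1// ltW.
rewrite ler_pdivrMr// mul1r -NE /Y; apply/idP/idP => [XN|].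
  by apply: ge0_ler_powR; rewrite ?nnegrE//; exact: ltW.
apply: contraTT; rewrite -!ltNge => NX.
by apply: gt0_ltr_powR; rewrite ?nnegrE//; exact: ltW.
Qed.

Definition level_risk_const : R :=
  4 * Cb / ca ^+ 2 + 64 + 4 * (1 + ca^-1) * (`|ln ((1 + Ca) / cw)| + 2 + g) +
  5 * Cb + 48 * Ca.

Let K0 := `|ln ((1 + Ca) / cw)| + 2 + g.
Let lm0 : 0 <= ln m. Proof. exact: ln_ge0. Qed.

(** Levels with 2^(alpha j) <= n. The odds bound Q of the spike grows polynomially
    in n since 2^(gamma j) <= n^gamma, so ln Q is of order 1 + ln n; the squared
    bias is of order (Y / m) * (X / m), below the variance X / m. *)
Lemma level_risk_coarse : Y <= m ->
  4 * ((m^-1 / a2) ^+ 2) * S +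
    X * (64 / m + 4 / m * (1 + m^-1 / a2) * (ln ((1 + a2 * m) / v) + 1)) <=
  (4 * Cb / ca ^+ 2 + 64 + 4 * (1 + ca^-1) * K0) * ((1 + ln m) * (X / m)).
Proof.
move=> Ym; case/andP: a2P; rewrite XNal => a2l a2u.
set q := m^-1 / a2; have q0 : 0 <= q by rewrite divr_ge0 ?invr_ge0 ?ltW.
have qY : q <= Y / m / ca.
  rewrite /q ler_pdivrMr//; apply: le_trans (ler_wpM2l _ a2l); last first.
    by rewrite !divr_ge0 ?ltW.
  rewrite le_eqVlt; apply/orP; left; apply/eqP; field.
  by rewrite !gt_eqF.
have Ym1 : Y / m <= 1 by rewrite ler_pdivrMr// mul1r.
have Ym0 : 0 <= Y / m by rewrite divr_ge0// ltW.
have q1 : q <= ca^-1.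
  by apply: le_trans qY _; rewrite ler_piMl// invr_ge0 ltW.
have Xm0 : 0 <= X / m by rewrite divr_ge0// ltW.
have T1 : 4 * q ^+ 2 * S <= 4 * Cb / ca ^+ 2 * (X / m).
  have qq : q ^+ 2 <= (Y / m / ca) ^+ 2.
    by rewrite ler_pXn2r ?nnegrE//; exact: le_trans qY.
  move: SP; rewrite XNal1 => SP'.
  have : q ^+ 2 * S <= (Y / m / ca) ^+ 2 * (Cb * (X / Y)).
    by apply: ler_pM => //; exact: sqr_ge0.
  have -> : (Y / m / ca) ^+ 2 * (Cb * (X / Y)) = Cb / ca ^+ 2 * (X / m) * (Y / m).
    by field; rewrite !gt_eqF.
  have : Cb / ca ^+ 2 * (X / m) * (Y / m) <= Cb / ca ^+ 2 * (X / m).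
    by rewrite ler_piMr// mulr_ge0// divr_ge0 ?sqr_ge0// ltW.
  lra.
have a2Ca : a2 <= Ca.
  by apply: le_trans a2u _; rewrite ler_piMr ?(ltW Ca0)// invf_le1.
have lX : ln X <= ln m.
  rewrite ler_ln ?posrE//; apply: le_trans Ym; apply: le1r_powR => //.
  exact: ltW.
have L : ln ((1 + a2 * m) / v) <= ln ((1 + Ca) / cw) + (1 + g) * ln m.
  have pos1 : 0 < (1 + Ca) / cw by rewrite divr_gt0// addr_gt0.
  have Xg0 : 0 < X `^ g by exact: powR_gt0.
  have pos2 : 0 < m * X `^ g by exact: mulr_gt0.
  apply: (@le_trans _ _ (ln ((1 + Ca) / cw * (m * X `^ g)))); last first.
    rewrite [leLHS]lnM ?posrE// [ln (m * _)]lnM ?posrE// ln_powR lerD2l mulrDl mul1r lerD2l.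
    exact: ler_wpM2l.
  rewrite ler_ln ?posrE; last 2 first.
  - by rewrite divr_gt0// addr_gt0// mulr_gt0.
  - exact: mulr_gt0.
  rewrite ler_pdivrMr//.
  have h1 : 1 + a2 * m <= (1 + Ca) * m.
    have := ler_wpM2r (ltW m0) a2Ca; rewrite /=.
    by have := m1; lra.
  apply: (le_trans h1).
  have h2 : 1 <= X `^ g / cw * v.
    move: vP; rewrite powRN => h; have := ler_wpM2l (ltW (divr_gt0 Xg0 cw0)) h.
    by apply: le_trans; rewrite le_eqVlt; apply/orP; left; apply/eqP; field; rewrite !gt_eqF.
  have h3 : 0 <= (1 + Ca) * m by rewrite mulr_ge0 ?addr_ge0 ?ltW.
  have := ler_wpM2l h3 h2; rewrite mulr1.
  by congr (_ <= _); field; rewrite gt_eqF.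
have L2 : ln ((1 + a2 * m) / v) + 1 <= K0 * (1 + ln m).
  have := ler_norm (ln ((1 + Ca) / cw)); have n0 := normr_ge0 (ln ((1 + Ca) / cw)).
  have : 0 <= `|ln ((1 + Ca) / cw)| * ln m by exact: mulr_ge0.
  by have := lm0; have := g0; have := L; rewrite /K0; lra.
have K00 : 0 <= K0 by rewrite /K0 !addr_ge0.
have T2 : X * (64 / m) <= 64 * ((1 + ln m) * (X / m)).
  have : 0 <= ln m * (X / m) by exact: mulr_ge0.
  have -> : X * (64 / m) = 64 * (X / m) by ring.
  lra.
have T3 : X * (4 / m * (1 + q) * (ln ((1 + a2 * m) / v) + 1)) <=
    4 * (1 + ca^-1) * K0 * ((1 + ln m) * (X / m)).
  have -> : X * (4 / m * (1 + q) * (ln ((1 + a2 * m) / v) + 1)) =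
    4 * (X / m) * ((1 + q) * (ln ((1 + a2 * m) / v) + 1)) by ring.
  have -> : 4 * (1 + ca^-1) * K0 * ((1 + ln m) * (X / m)) =
    4 * (X / m) * ((1 + ca^-1) * (K0 * (1 + ln m))) by ring.
  apply: ler_wpM2l; first by rewrite mulr_ge0.
  apply: (@le_trans _ _ ((1 + q) * (K0 * (1 + ln m)))).
    by apply: ler_wpM2l => //; rewrite addr_ge0.
  by apply: ler_wpM2r; [rewrite mulr_ge0// addr_ge0|rewrite lerD2l].
have T1' : 4 * Cb / ca ^+ 2 * (X / m) <= 4 * Cb / ca ^+ 2 * ((1 + ln m) * (X / m)).
  apply: ler_wpM2l; first by rewrite divr_ge0 ?sqr_ge0// mulr_ge0// ltW.
  by rewrite ler_peMl// lerDl.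
lra.
Qed.

Lemma level_risk_fine : 5 * S + 48 * (X * a2) <= (5 * Cb + 48 * Ca) * (X / Y).
Proof.
case/andP: a2P; rewrite XNal => _ a2u; move: SP; rewrite XNal1 => SP'.
have := ler_wpM2l (ltW X0) a2u.
have -> : X * (Ca / Y) = Ca * (X / Y) by ring.
lra.
Qed.

Lemma level_risk_le (r : R) :
  r <= 4 * ((m^-1 / a2) ^+ 2) * S +
    X * (64 / m + 4 / m * (1 + m^-1 / a2) * (ln ((1 + a2 * m) / v) + 1)) ->
  r <= 5 * S + 48 * (X * a2) ->
  r <= level_risk_const * (1 + ln m) * rho * profile (al - 1) (X / N).
Proof.
move=> r1 r2; rewrite /profile scaleE.
have K00 : 0 <= K0 by rewrite /K0 !addr_ge0.
have c1 : 0 <= 4 * Cb / ca ^+ 2 + 64 + 4 * (1 + ca^-1) * K0.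
  rewrite addr_ge0 ?mulr_ge0 ?addr_ge0 ?invr_ge0 ?(ltW ca0)//.
  by rewrite divr_ge0 ?sqr_ge0// mulr_ge0// ltW.
have c2 : 0 <= 5 * Cb + 48 * Ca by rewrite addr_ge0// mulr_ge0// ltW.
have constE : level_risk_const = (4 * Cb / ca ^+ 2 + 64 + 4 * (1 + ca^-1) * K0) + (5 * Cb + 48 * Ca).
  by rewrite /level_risk_const /K0; ring.
have [Ym|mY] := leP Y m.
  apply: (le_trans r1); apply: (le_trans (level_risk_coarse Ym)).
  have -> : level_risk_const * (1 + ln m) * rho * (X / N) =
      level_risk_const * ((1 + ln m) * (X / m)).
    by rewrite rhoE; field; rewrite !gt_eqF.
  apply: ler_wpM2r; first by rewrite mulr_ge0 ?addr_ge0// divr_ge0// ltW.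
  by rewrite constE lerDl.
apply: (le_trans r2); apply: (le_trans level_risk_fine).
have XYE : rho * (X / N) `^ (- (al - 1)) = X / Y.
  rewrite powRM ?invr_ge0 ?(ltW X0) ?(ltW N0)// XNal1.
  have -> : (N^-1) `^ (- (al - 1)) = rho^-1.
    rewrite -[N^-1]powR_inv1 ?(ltW N0)// /N -!powRrM /rho -powRN; congr (_ `^ _).
    by field; rewrite gt_eqF// (lt_trans _ al1).
  by field; rewrite !gt_eqF//= ?powR_gt0.
have XY0 : 0 <= X / Y by rewrite divr_ge0// ltW.
have -> : level_risk_const * (1 + ln m) * rho * (X / N) `^ (- (al - 1)) =
    level_risk_const * ((1 + ln m) * (X / Y)) by rewrite -XYE; ring.
apply: (@le_trans _ _ (level_risk_const * (X / Y))).
  by apply: ler_wpM2r => //; rewrite constE lerDr.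
apply: ler_wpM2l; first by rewrite constE addr_ge0.
by rewrite ler_peMl// lerDl.
Qed.

End level_risk.
(** * The rate of convergence *)

Lemma cvge0_le (R : realType) (u : nat -> \bar R) : (forall n, 0 <= u n)%E ->
  (forall e : R, 0 < e -> exists N, forall n, (N <= n)%N -> (u n <= e%:E)%E) ->
  u @ \oo --> 0%E.
Proof.
move=> u0 ule; apply/fine_cvgP; split.
  have [N uN] := ule 1 ltr01; exists N => // n /uN un.
  by rewrite ge0_fin_numE//; apply: le_lt_trans un _; rewrite ltry.
apply/cvgrPdist_le => e e0; have [N uN] := ule e e0; exists N => // n /uN un /=.
have un0 := fine_ge0 (u0 n); rewrite sub0r normrN ger0_norm//.
rewrite -lee_fin fineK// ge0_fin_numE//; apply: le_lt_trans un _.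
by rewrite ltry.
Qed.

Lemma nneseries_le_bound (R : realType) (u : nat -> \bar R) (c : \bar R) :
  (forall j, 0 <= u j)%E -> (forall N, \sum_(0 <= j < N) u j <= c)%E ->
  (\sum_(0 <= j <oo) u j <= c)%E.
Proof.
move=> u0 uc; apply: lime_le; first by apply: is_cvg_nneseries => j _ _.
by apply: nearW => N; exact: uc.
Qed.

Section risk_rate.
Context {R : realType}.
Variables (al g ca Ca cw Cb : R).
Hypotheses (al1 : 1 < al) (g0 : 0 <= g) (ca0 : 0 < ca) (Ca0 : 0 < Ca).
Hypotheses (cw0 : 0 < cw) (Cb0 : 0 < Cb).
Variables (a w : nat -> R) (b0 : coefs R).
Hypotheses (a0 : forall j, 0 < a j) (w01 : forall j, 0 <= w j <= 1).
Hypothesis aP : forall j,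
  ca * (2 `^ j%:R) `^ (- al) <= a j ^+ 2 <= Ca * (2 `^ j%:R) `^ (- al).
Hypothesis wP : forall j, cw * (2 `^ j%:R) `^ (- g) <= w j.
Hypothesis bP : forall j,
  \sum_(k < 2 ^ j) b0 (widx k) ^+ 2 <= Cb * (2 `^ j%:R) `^ (- (al - 1)).

Let X1 j : 1 <= 2 `^ j%:R :> R.
Proof. by rewrite -natr_2expn ler1n expn_gt0. Qed.

Let profile_const : R := 2 + (1 - 2 `^ (- (al - 1)))^-1.

Let al10 : 0 < al - 1. Proof. by rewrite subr_gt0. Qed.

Lemma total_risk_le n : (0 < n)%N ->
  (\sum_(0 <= j <oo) \sum_(k < 2 ^ j) \int[normal_prob 0 1]_y
     (post_risk (w j) (a j) (Num.sqrt n%:R)^-1 (b0 (widx k))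
        (b0 (widx k) + (Num.sqrt n%:R)^-1 * y))%:E <=
   (level_risk_const g ca Ca cw Cb * (1 + ln n%:R) *
      n%:R `^ (- ((al - 1) / al)) * profile_const)%:E)%E.
Proof.
move=> n0; set s : R := (Num.sqrt n%:R)^-1.
have s0 : 0 < s by rewrite invr_gt0 sqrtr_gt0 ltr0n.
have s2 : s ^+ 2 = n%:R^-1 by rewrite exprVn sqr_sqrtr.
have m1 : 1 <= n%:R :> R by rewrite ler1n.
have m0 : 0 < n%:R :> R by rewrite ltr0n.
have w0 j : 0 < w j.
  apply: lt_le_trans (wP j); rewrite mulr_gt0 ?powR_gt0//.
set I := fun j (k : 'I_(2 ^ j)) => (\int[normal_prob 0 1]_y
  (post_risk (w j) (a j) s (b0 (widx k)) (b0 (widx k) + s * y))%:E)%E.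
have I0 j k : (0 <= I j k)%E.
  by apply: integral_ge0 => y _; rewrite lee_fin; exact: post_risk_ge0.
pose S j := \sum_(k < 2 ^ j) b0 (widx k) ^+ 2.
have hfine j : (\sum_(k < 2 ^ j) I j k <= (5 * S j + 48 * (2 `^ j%:R * a j ^+ 2))%:E)%E.
  apply: (@le_trans _ _ (\sum_(k < 2 ^ j) (5 * b0 (widx k) ^+ 2 + 48 * a j ^+ 2)%:E)%E).
    by apply: lee_sum => k _; exact: integral_post_risk_le_prior.
  rewrite sumEFin lee_fin big_split/= -mulr_sumr sumr_const card_ord.
  by rewrite -[_ *+ (2 ^ j)%N]mulr_natl natr_2expn lerD2l mulrCA.
have hcoarse j : (\sum_(k < 2 ^ j) I j k <=
    (4 * ((n%:R^-1 / a j ^+ 2) ^+ 2) * S j + 2 `^ j%:R * (64 / n%:R + 4 / n%:R *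
      (1 + n%:R^-1 / a j ^+ 2) * (ln ((1 + a j ^+ 2 * n%:R) / w j) + 1)))%:E)%E.
  apply: le_trans (lee_sum _ (fun k _ =>
    integral_post_risk_le_noise (b0 (widx k)) (w01 j) (a0 j) s0 (w0 j))) _.
  rewrite sumEFin lee_fin s2 invrK.
  under eq_bigr do rewrite -addrA.
  rewrite big_split/= -mulr_sumr sumr_const card_ord.
  by rewrite -[_ *+ (2 ^ j)%N]mulr_natl natr_2expn.
have level j : (\sum_(k < 2 ^ j) I j k <=
    (level_risk_const g ca Ca cw Cb * (1 + ln n%:R) * n%:R `^ (- ((al - 1) / al)) *
      profile (al - 1) (2 `^ j%:R / n%:R `^ al^-1))%:E)%E.
  have fin : (\sum_(k < 2 ^ j) I j k)%E \is a fin_num.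
    rewrite ge0_fin_numE; last by apply: sume_ge0.
    by apply: le_lt_trans (hfine j) _; rewrite ltry.
  have S0 : 0 <= S j by apply: sumr_ge0 => k _; exact: sqr_ge0.
  move: (hfine j) (hcoarse j); rewrite -(fineK fin) !lee_fin => hf hc.
  exact: (level_risk_le al1 g0 ca0 Ca0 cw0 Cb0 (X1 j) m1 S0 (aP j) (wP j) (bP j) hc hf).
apply: nneseries_le_bound => [j|N]; first by apply: sume_ge0 => k _; exact: I0.
apply: le_trans (lee_sum _ (fun j _ => level j)) _.
rewrite sumEFin lee_fin -mulr_sumr; apply: ler_wpM2l; last first.
  by apply: sum_profile_le => //; exact: powR_gt0.
rewrite !mulr_ge0 ?powR_ge0//; last by rewrite addr_ge0// ln_ge0.
rewrite /level_risk_const !addr_ge0 ?mulr_ge0 ?addr_ge0 ?invr_ge0 ?sqr_ge0 ?normr_ge0//; exact: ltW.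
Qed.

(** The prior concentrates on square-summable sequences: its variance on level j, summed
    over the level, is at most of order 2^(- (alpha - 1) j). *)
Lemma prior_sq_dist_fin (Pi : probability (coefs R) R) :
  spike_slab_prior w a Pi -> (\int[Pi]_b sq_dist b b0 < +oo)%E.
Proof.
move=> hPi.
rewrite (integral_level_sum Pi (f := fun i (b : coefs R) => (b i - b0 i) ^+ 2) measurableT).
- apply: (@le_lt_trans _ _ ((2 * Cb + 16 * Ca) * profile_const)%:E); last by rewrite ltry.
  apply: nneseries_le_bound => [j|N].
    by apply: sume_ge0 => k _; apply: integral_ge0 => b _; rewrite lee_fin sqr_ge0.
  apply: (@le_trans _ _ (\sum_(0 <= j < N)
      ((2 * Cb + 16 * Ca) * profile (al - 1) (2 `^ j%:R / 1))%:E)%E).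
    apply: lee_sum => j _.
    apply: le_trans (lee_sum _ (fun k _ =>
      prior_second_moment w01 a0 hPi (widx k) (b0 (widx k)))) _.
    rewrite sumEFin lee_fin /= big_split/= -mulr_sumr sumr_const card_ord -[_ *+ (2 ^ j)%N]mulr_natl natr_2expn.
    have -> : profile (al - 1) (2 `^ j%:R / 1) = (2 `^ j%:R) `^ (- (al - 1)) :> R.
      rewrite /profile divr1; case: ifP => // Xle.
      have -> : 2 `^ j%:R = 1 :> R by apply/eqP; rewrite eq_le Xle X1.
      by rewrite powR1.
    case/andP: (aP j) => _ ajle.
    have X0 : 0 < 2 `^ j%:R :> R by exact: powR_gt0.
    have := ler_wpM2l (ltW X0) ajle; rewrite [X in _ <= X -> _]mulrCA; have := bP j.
    have -> : (2 `^ j%:R : R) `^ (- (al - 1)) = 2 `^ j%:R * (2 `^ j%:R) `^ (- al).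
      by rewrite opprB addrC -powRD_gt0// powRr1 ?(ltW X0)// mulrC.
    lra.
  rewrite sumEFin lee_fin -mulr_sumr; apply: ler_wpM2l; last exact: sum_profile_le.
  by rewrite addr_ge0// mulr_ge0// ltW.
- move=> i; apply: measurable_funX; apply: measurable_funB => //.
  exact: measurable_coord.
- by move=> i b; exact: sqr_ge0.
Qed.

End risk_rate.

Theorem theorem1 (R : realType)
  (* noise variables z_jk on an arbitrary probability space *)
  (d : measure_display) (T : measurableType d) (P : probability T R)
  (z : windex -> {RV P >-> R}) (hz : std_gaussian_noise z)
  (p q : \bar R) (hp : (1%:E <= p)%E) (hq : (1%:E <= q)%E)
  (s : R) (hs : Num.max 0 (rinv p - 2^-1) < s)
  (B : R) (hB : 0 < B)
  (* a00: known scaling coefficient; b0: true wavelet coefficients *)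
  (a00 : R) (b0 : coefs R) (hb0 : besov_ball s p q a00 B b0)
  (* a j: standard deviation of the slab; w j: its mixing weight *)
  (a w : nat -> R) (gamma : R) (hgamma : 0 <= gamma)
  (ha : asymp (fun j => a j ^+ 2) (fun j => 2 `^ (- (alpha s p * j%:R))))
  (hw01 : forall j, 0 <= w j <= 1)
  (hw : asymp w (fun j => 2 `^ (- (gamma * j%:R))))
  (Pi : nat -> probability (coefs R) R)
  (hPi : forall n, spike_slab_prior w a (Pi n))
  (hmass : forall n, (0 < Pi n (besov_space s p q a00))%E)
  (post : nat -> R.-pker (coefs R) ~> (coefs R))
  (hpost : forall n, (0 < n)%N -> is_posterior z n (Pi n) (post n)) :
  exists M0 : R, forall M : R, M0 <= M ->
    cvg_in_probability P
      (fun n omega =>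
         post n (obs z n b0 omega)
           [set b | ((M * rate2 s p n)%:E < sq_dist b b0)%E])
      0.
Proof.
have al1 := alpha_gt1 hp hs; set al := alpha s p in ha al1.
case: ha => ca [Ca [ca0 Ca0 ha]]; case: hw => cw [Cw [cw0 Cw0 hw]].
have powE (x : R) (j : nat) : 2 `^ (- (x * j%:R)) = (2 `^ j%:R) `^ (- x) :> R.
  by rewrite -powRrM; congr (_ `^ _); ring.
have Xx0 (x : R) (j : nat) : 0 < (2 `^ j%:R) `^ (- x) :> R by rewrite !powR_gt0.
(* the sign of a j does not affect N(0, a j ^ 2) *)
pose a' j := `|a j|.
have a'P j : ca * (2 `^ j%:R) `^ (- al) <= a' j ^+ 2 <= Ca * (2 `^ j%:R) `^ (- al).
  rewrite real_normK ?num_real//; have := ha j; rewrite powE.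
  by rewrite ler_pdivlMr// ler_pdivrMr.
have a'0 j : 0 < a' j.
  rewrite normr_gt0; apply/eqP => aj0; have /andP[] := a'P j.
  by rewrite /a' aj0 normr0 expr0n/= leNgt mulr_gt0.
have wP j : cw * (2 `^ j%:R) `^ (- gamma) <= w j.
  by have /andP[] := hw j; rewrite powE ler_pdivlMr.
have bP j := besov_ball_l2 j hp hq hB hb0.
have hPi' n : spike_slab_prior w a' (Pi n).
  split; first exact: (hPi n).1.
  move=> i A mA; rewrite ((hPi n).2 i A mA) /spike_slab; congr (_ * _ + _)%E.
  by rewrite normal_prob_norm.
have Cb0 : 0 < 2 * B ^+ 2 by rewrite mulr_gt0 ?exprn_gt0.
exists 1 => M M1 e e0; have M0 : 0 < M by exact: lt_le_trans M1.
set LC := level_risk_const gamma ca Ca cw (2 * B ^+ 2).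
set PC : R := 2 + (1 - 2 `^ (- (al - 1)))^-1.
(* the risk bound has one logarithm less than the rate *)
have tail n : (1 < n)%N -> (P [set omega | (e%:E < `|post n (obs z n b0 omega)
      [set b | ((M * rate2 s p n)%:E < sq_dist b b0)%E] - 0%:E|)%E] <=
    (2 * LC * PC / (e * M) * ((1 + ln n%:R) / ln n%:R ^+ 2))%:E)%E.
  move=> n1; have n0 : (0 < n)%N by exact: ltnW.
  have L0 : 0 < ln n%:R :> R by rewrite ln_gt0// ltr1n.
  have rho0 : 0 < n%:R `^ (- ((al - 1) / al)) :> R by rewrite powR_gt0// ltr0n.
  have rateE : rate2 s p n = ln n%:R ^+ 2 * n%:R `^ (- ((al - 1) / al)) by exact: rate2E.
  have delta0 : 0 < M * rate2 s p n by rewrite rateE !mulr_gt0 ?exprn_gt0.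
  under eq_set do rewrite sube0 gee0_abs//.
  have fin := prior_sq_dist_fin al1 Ca0 Cb0 a'0 hw01 a'P bP (hPi' n).
  apply: le_trans (posterior_tail_le hz n0 hw01 a'0 (hPi' n) fin (hpost n n0) delta0 e0) _.
  have k0 : (0 <= (2 / (e * (M * rate2 s p n)))%:E :> \bar R)%E.
    by rewrite lee_fin divr_ge0// mulr_ge0// ltW.
  apply: le_trans (lee_wpmul2l k0
    (total_risk_le al1 hgamma ca0 Ca0 cw0 Cb0 a'0 hw01 a'P wP bP n0)) _.
  rewrite -EFinM lee_fin rateE -/LC -/PC le_eqVlt; apply/orP; left; apply/eqP.
  field; by rewrite !gt_eqF.
apply: cvge0_le => [n|eps eps0]; first exact: measure_ge0.
set Q := 2 * LC * PC / (e * M) in tail.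
pose Q' := `|Q| + 1.
have Q'0 : 0 < Q' by rewrite ltr_wpDl.
pose L := 1 + 2 * Q' / eps.
exists (maxn 2 (Num.truncn (expR L)).+1) => n; rewrite geq_max => /andP[n1 nL].
apply: le_trans (tail n n1) _; rewrite lee_fin.
have Ln : L <= ln n%:R.
  rewrite -[L]expRK ler_ln ?posrE ?expR_gt0 ?ltr0n ?(ltnW n1)//.
  by apply: ltW; apply: lt_le_trans (truncnS_gt _) _; rewrite ler_nat.
have QL0 : 0 < 2 * Q' / eps by rewrite divr_gt0// mulr_gt0.
have L1 : 1 <= ln n%:R :> R by apply: le_trans Ln; rewrite lerDl ltW.
have Lpos : 0 < ln n%:R :> R by exact: lt_le_trans L1.
have QQ' : Q <= Q' by apply: le_trans (ler_norm _) _; rewrite lerDl.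
have ratio : (1 + ln n%:R) / ln n%:R ^+ 2 <= 2 / ln n%:R :> R.
  rewrite ler_pdivrMr ?exprn_gt0// expr2 mulrA divfK ?gt_eqF//.
  by lra.
have r0 : 0 <= (1 + ln n%:R) / ln n%:R ^+ 2 :> R.
  by rewrite divr_ge0 ?sqr_ge0// addr_ge0// ltW.
apply: (@le_trans _ _ (Q' * (2 / ln n%:R))).
  apply: (@le_trans _ _ (Q' * ((1 + ln n%:R) / ln n%:R ^+ 2))); first exact: ler_wpM2r.
  by apply: ler_wpM2l => //; exact: ltW.
rewrite mulrA ler_pdivrMr// mulrC.
have : 2 * Q' / eps <= ln n%:R by apply: le_trans Ln; rewrite lerDr.
by rewrite ler_pdivrMr// [X in _ <= X -> _]mulrC.
Qed.
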